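(* Let $(M,E)$ be a Finsler space with canonical spray $S$ and Chern connection $\overset{\ast}{D}$. The $h$-curvature $\overset{\ast}{R}$ and $hv$-curvature $\overset{\ast}{P}$ of $\overset{\ast}{D}$ satisfy, for all $X,Y,Z\in\mathfrak{X}(TM)$: (a) $\overset{\ast}{R}(X,Y)S=\mathfrak{R}(X,Y)$; (b) $\overset{\ast}{P}(X,Y)S=\overset{\ast}{P}(S,Y)X=\mathcal{C}'(X,Y)$; (c) $\overset{\ast}{P}(X,S)Z=0$.
   Context: Setting. $M$ is a real $C^\infty$ manifold of finite dimension $n$, $TM$ its tangent bundle, $\mathcal{T}M$ the bundle of nonzero tangent vectors. $J$ is the natural almost-tangent structure (vertical endomorphism) of $TM$ (locally $J(\partial/\partial x^i)=\partial/\partial y^i$, $J(\partial/\partial y^i)=0$) and $C=y^i\partial/\partial y^i$ is the Liouville vector field. Brackets of vector forms are Frölicher-Nijenhuis brackets; for a vector $1$-form $L$ and vector field $X$, $[X,L]Y=[X,LY]-L[X,Y]$, $[L,X]=-[X,L]$. Finsler space $(M,E)$: $E:TM\to\mathbb{R}$ with $E>0$ on $\mathcal{T}M$, $E(0)=0$, $E$ $C^\infty$ on $\mathcal{T}M$ and $C^1$ on $TM$, $\mathcal{L}_CE=2E$, and $\Omega:=dd_JE$ of maximal rank, where $d_JE(X)=dE(JX)$. Canonical spray $S$: $i_S\Omega=-dE$ (it satisfies $JS=C$, $[C,S]=S$). Barthel connection: $\Gamma=[J,S]$, with projectors $h=\frac12(I+\Gamma)$, $v=\frac12(I-\Gamma)$;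 its curvature is $\mathfrak{R}=-\frac12[h,h]$, i.e. $\mathfrak{R}(X,Y)=-v[hX,hY]$. The almost-complex structure $F$ is defined by $FJ=h$, $Fh=-J$; the metric is $g(X,Y)=\Omega(X,FY)$. $\mathcal{C}'$ is the symmetric vertical-valued bilinear tensor defined by $\Omega(\mathcal{C}'(X,Y),Z)=\frac12(\mathcal{L}_{hX}g)(JY,JZ)$. Regularity convention: objects built from $E$ are smooth only on $\mathcal{T}M$; linear connections on $TM$ and vector fields in $\mathfrak{X}(TM)$ are understood on $\mathcal{T}M$. Chern connection: the unique linear connection $\overset{\ast}{D}$ on $TM$ such that $\overset{\ast}{D}J=0$, $\overset{\ast}{D}C=v$, $\overset{\ast}{D}\Gamma=0$, $\overset{\ast}{D}_{JX}JY=J[JX,Y]$ (i.e. a normal lift of $\Gamma$), $\overset{\ast}{D}_{hX}g=0$, and $J\,\overset{\ast}{T}(hX,hY)=0$ for all $X,Y$, where $\overset{\ast}{T}$ is its classical torsion. Explicitly it is determined by $\overset{\ast}{D}_{JX}JY=J[JX,Y]$, $\overset{\ast}{D}_{hX}JY=v[hX,JY]+\mathcal{C}'(X,Y)$, $\overset{\ast}{D}F=0$. With $K(X,Y)Z=\overset{\ast}{D}_X\overset{\ast}{D}_YZ-\overset{\ast}{D}_Y\overset{\ast}{D}_XZ-\overset{\ast}{D}_{[X,Y]}Z$, the $h$- and $hv$-curvatures are $\overset{\ast}{R}(X,Y)Z=K(hX,hY)JZ$ and $\overset{\ast}{P}(X,Y)Z=K(hX,JY)JZ$. *)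

(* Defs.v *)
From HB Require Import structures.
From mathcomp Require Import all_boot all_order all_algebra.
From mathcomp Require Import all_classical all_reals all_analysis.
Set Implicit Arguments.
Unset Strict Implicit.
Unset Printing Implicit Defensive.
Import Order.TTheory GRing.Theory Num.Theory.
Import numFieldNormedType.Exports.
Local Open Scope classical_set_scope.
Local Open Scope ring_scope.

(* Meant for open U: f is C^(k+1) iff it is Frechet differentiable and all its
   directional derivatives are C^k. *)
Fixpoint Ck (R : realType) (V W : normedModType R) (k : nat)
    (U : set V) (f : V -> W) : Prop :=
  match k with
  | 0 => forall x, U x -> {for x, continuous f}
  | k'.+1 => (forall x, U x -> differentiable f x) /\
             (forall w : V, Ck k' U (fun x => 'D_w f x))
  end.

Definition Coo (R : realType) (V W : normedModType R)
    (U : set V) (f : V -> W) : Prop := forall k, Ck k U f.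

(* The raw data of an atlas: coord a is meaningful on dom a only.  As in
   Mathlib, every point p comes with a preferred chart chart_at p around it, and
   a tangent vector at p is represented by the vector of its m components in
   that preferred chart. *)
Record atlas (R : realType) (m : nat) (N : Type) := Atlas {
  chart : Type;
  dom : chart -> set N;
  coord : chart -> N -> 'rV[R]_m;
  chart_at : N -> chart }.

Section Calculus.
Context {R : realType} {m : nat} {N : Type} (A : atlas R m N).

(* f o (coord a)^-1 on coord a (dom a), and 0 elsewhere. *)
Definition local_expr (W : normedModType R) (a : chart A) (f : N -> W) :
    'rV[R]_m -> W :=
  fun z => xget 0 [set f p | p in [set p | dom a p /\ coord a p = z]].

Definition chart_image (a : chart A) : set 'rV[R]_m := coord a @` dom a.

Definition transition (a b : chart A) : 'rV[R]_m -> 'rV[R]_m :=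
  local_expr a (coord b).

Definition Ck_fun (k : nat) (f : N -> R) : Prop :=
  forall a : chart A, Ck k (chart_image a) (local_expr a (f : N -> R^o)).

Definition smooth_fun (f : N -> R) : Prop := forall k, Ck_fun k f.

(* The components in the chart a of the tangent vector at p whose components in
   the preferred chart at p are v. *)
Definition components (a : chart A) (p : N) (v : 'rV[R]_m) : 'rV[R]_m :=
  'D_v (transition (chart_at A p) a) (coord (chart_at A p) p).

Definition field : Type := N -> 'rV[R]_m.

Definition local_field (a : chart A) (X : field) : 'rV[R]_m -> 'rV[R]_m :=
  local_expr a (fun p => components a p (X p)).

Definition smooth_field (X : field) : Prop :=
  forall a : chart A, Coo (chart_image a) (local_field a X).

(* The derivative X(f) = df(X). *)
Definition act (X : field) (f : N -> R) : N -> R := fun p =>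
  let a := chart_at A p in
  'D_(X p) (local_expr a (f : N -> R^o)) (coord a p).

Definition lie (X Y : field) : field := fun p =>
  let a := chart_at A p in
  'D_(X p) (local_field a Y) (coord a p) -
  'D_(Y p) (local_field a X) (coord a p).

Definition fscale (f : N -> R) (X : field) : field := fun p => f p *: X p.

Definition vector_1form (L : field -> field) : Prop :=
  [/\ forall X, smooth_field X -> smooth_field (L X),
      forall X Y, smooth_field X -> smooth_field Y -> L (X + Y) = L X + L Y
    & forall f X, smooth_fun f -> smooth_field X ->
        L (fscale f X) = fscale f (L X)].

Definition vector_bilinear (B : field -> field -> field) : Prop :=
  (forall X, smooth_field X -> vector_1form (B X)) /\
  (forall Y, smooth_field Y -> vector_1form (B ^~ Y)).

(* The exterior derivative of a scalar 1-form. *)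
Definition ext_d (w : field -> N -> R) (X Y : field) : N -> R :=
  act X (w Y) - act Y (w X) - w (lie X Y).

(* The Lie derivative of a scalar bilinear form. *)
Definition lie_bilinear (X : field) (g : field -> field -> N -> R)
    (Y Z : field) : N -> R :=
  act X (g Y Z) - g (lie X Y) Z - g Y (lie X Z).

(* The Froelicher-Nijenhuis brackets [X, L], [L, X] and [K, L], for a vector
   field X and vector 1-forms K, L. *)
Definition fn_field_form (X : field) (L : field -> field) (Y : field) : field :=
  lie X (L Y) - L (lie X Y).

Definition fn_form_field (L : field -> field) (X : field) (Y : field) : field :=
  - fn_field_form X L Y.

Definition fn_form_form (K L : field -> field) (X Y : field) : field :=
  lie (K X) (L Y) + lie (L X) (K Y) + K (L (lie X Y)) + L (K (lie X Y))
  - K (lie (L X) Y) - K (lie X (L Y)) - L (lie (K X) Y) - L (lie X (K Y)).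

Definition linear_connection (D : field -> field -> field) : Prop :=
  [/\ forall Y, smooth_field Y -> vector_1form (D ^~ Y),
      forall X Y Z, smooth_field X -> smooth_field Y -> smooth_field Z ->
        D X (Y + Z) = D X Y + D X Z
    & forall f X Y, smooth_fun f -> smooth_field X -> smooth_field Y ->
        D X (fscale f Y) = fscale (act X f) Y + fscale f (D X Y)].

Definition torsion (D : field -> field -> field) (X Y : field) : field :=
  D X Y - D Y X - lie X Y.

Definition curvature (D : field -> field -> field) (X Y Z : field) : field :=
  D X (D Y Z) - D Y (D X Z) - D (lie X Y) Z.

End Calculus.

Record manifold (R : realType) (n : nat) := Manifold {
  carrier :> topologicalType;
  charts : atlas R n carrier;
  manifold_hausdorff : hausdorff_space carrier;
  manifold_second_countable : @second_countable carrier;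
  dom_chart_at : forall p, dom (chart_at charts p) p;
  dom_open : forall a : chart charts, open (dom a);
  coord_inj : forall (a : chart charts) (p q : carrier),
    dom a p -> dom a q -> coord a p = coord a q -> p = q;
  coord_continuous : forall (a : chart charts) (p : carrier),
    dom a p -> {for p, continuous (coord a)};
  coord_open : forall (a : chart charts) (U : set carrier),
    open U -> U `<=` dom a -> open (coord a @` U);
  transition_smooth : forall a b : chart charts,
    Coo (coord a @` (dom a `&` dom b)) (transition a b) }.

Section TangentBundle.
Context {R : realType} {n : nat} (M : manifold R n).

(* (p, v) is the vector with components v in the preferred chart at p. *)
Definition TM : Type := (carrier M * 'rV[R]_n)%type.

(* The charts (x, y) of TM induced by the charts x of M. *)
Definition TM_atlas : atlas R (n + n) TM := {|
  chart := chart (charts M);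
  dom := fun a => [set u | dom a u.1];
  coord := fun a u => row_mx (coord a u.1) (components a u.1 u.2);
  chart_at := fun u => chart_at (charts M) u.1 |}.

(* The nonzero tangent vectors. *)
Definition slit : Type := {u : TM | u.2 != 0}.

Definition slit_atlas : atlas R (n + n) slit := {|
  chart := chart (charts M);
  dom := fun a => [set u | dom (a : chart TM_atlas) (sval u)];
  coord := fun a u => coord (a : chart TM_atlas) (sval u);
  chart_at := fun u => chart_at TM_atlas (sval u) |}.

Definition vfield : Type := @field R (n + n) slit.

Definition smooth_vfield (X : vfield) : Prop := smooth_field slit_atlas X.

(* xi^i d/dx^i + eta^i d/dy^i |-> xi^i d/dy^i *)
Definition Jform (X : vfield) : vfield := fun u => row_mx 0 (lsubmx (X u)).

(* y^i d/dy^i *)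
Definition liouville : vfield := fun u => row_mx 0 (sval u).2.

End TangentBundle.

Section Finsler.
Context {R : realType} {n : nat} (M : manifold R n).
Implicit Types (E : TM M -> R) (S X Y Z : vfield M).

Let T := slit_atlas M.
Let J : vfield M -> vfield M := @Jform R n M.
Let C : vfield M := @liouville R n M.

Definition slit_restr E : slit M -> R := fun u => E (sval u).

Definition d_E E X : slit M -> R := act T X (slit_restr E).

Definition dJ_E E X : slit M -> R := d_E E (J X).

(* Omega = d d_J E *)
Definition Omega E X Y : slit M -> R := ext_d T (dJ_E E) X Y.

Definition finsler_energy E : Prop :=
  [/\ forall u : slit M, 0 < E (sval u),
      forall p : M, E (p, 0) = 0,
      smooth_fun T (slit_restr E) /\ Ck_fun (TM_atlas M) 1 E,
      act T C (slit_restr E) = (fun u => 2 * E (sval u))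
    & (* Omega has maximal rank at every u: its kernel at u is zero *)
      forall (u : slit M) X, smooth_vfield X ->
        (forall Y, smooth_vfield Y -> Omega E X Y u = 0) -> X u = 0].

Definition canonical_spray E S : Prop :=
  smooth_vfield S /\
  forall X, smooth_vfield X -> Omega E S X = - d_E E X.

Definition barthel S : vfield M -> vfield M := fn_form_field T J S.

Definition hproj S X : vfield M := 2^-1 *: (X + barthel S X).

Definition vproj S X : vfield M := 2^-1 *: (X - barthel S X).

Definition barthel_curvature S X Y : vfield M :=
  - (2^-1 *: fn_form_form T (hproj S) (hproj S) X Y).

Definition almost_complex S (F : vfield M -> vfield M) : Prop :=
  vector_1form T F /\
  forall X, smooth_vfield X -> F (J X) = hproj S X /\ F (hproj S X) = - J X.

Definition metric E (F : vfield M -> vfield M) X Y : slit M -> R :=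
  Omega E X (F Y).

Definition second_cartan_tensor E S (F : vfield M -> vfield M)
    (Cp : vfield M -> vfield M -> vfield M) : Prop :=
  [/\ vector_bilinear T Cp,
      forall X Y, smooth_vfield X -> smooth_vfield Y -> Cp X Y = Cp Y X,
      forall X Y, smooth_vfield X -> smooth_vfield Y -> J (Cp X Y) = 0
    & forall X Y Z, smooth_vfield X -> smooth_vfield Y -> smooth_vfield Z ->
        Omega E (Cp X Y) Z =
        2^-1 *: (lie_bilinear T (hproj S X) (metric E F) (J Y) (J Z)
                   : slit M -> R^o)].

Definition normal_lift S (D : vfield M -> vfield M -> vfield M) : Prop :=
  [/\ linear_connection T D,
      forall X Y, smooth_vfield X -> smooth_vfield Y -> D X (J Y) = J (D X Y),
      forall X, smooth_vfield X -> D X C = vproj S X,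
      forall X Y, smooth_vfield X -> smooth_vfield Y ->
        D X (barthel S Y) = barthel S (D X Y)
    & forall X Y, smooth_vfield X -> smooth_vfield Y ->
        D (J X) (J Y) = J (lie T (J X) Y)].

Definition chern_connection E S (F : vfield M -> vfield M)
    (D : vfield M -> vfield M -> vfield M) : Prop :=
  [/\ normal_lift S D,
      forall X Y Z, smooth_vfield X -> smooth_vfield Y -> smooth_vfield Z ->
        act T (hproj S X) (metric E F Y Z) =
        metric E F (D (hproj S X) Y) Z + metric E F Y (D (hproj S X) Z)
    & forall X Y, smooth_vfield X -> smooth_vfield Y ->
        J (torsion T D (hproj S X) (hproj S Y)) = 0].

Definition h_curvature S (D : vfield M -> vfield M -> vfield M) X Y Z :
    vfield M :=
  curvature T D (hproj S X) (hproj S Y) (J Z).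

Definition hv_curvature S (D : vfield M -> vfield M -> vfield M) X Y Z :
    vfield M :=
  curvature T D (hproj S X) (J Y) (J Z).

End Finsler.

(* Main.v *)
From HB Require Import structures.
Require Import Defs.
From mathcomp Require Import all_boot all_order all_algebra.
From mathcomp Require Import all_classical all_reals all_analysis.
From mathcomp Require Import ring.
(* imported last, so that coord is the coordinate map of a chart *)
Require Import Defs.
Set Implicit Arguments.
Unset Strict Implicit.
Unset Printing Implicit Defensive.
Import Order.TTheory GRing.Theory Num.Theory.
Import numFieldNormedType.Exports.
Local Open Scope classical_set_scope.
Local Open Scope ring_scope.

(** The four claims are evaluations of the curvature K of the connection D on
    vertical fields, and three mechanisms produce them.

    Evaluation on the spray. The equation i_S Omega = -dE and the homogeneity
    of E give J S = C ([J_spray]), so that K(U,V)(J S) = K(U,V)C is computed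
    from D C = v alone: it is D_U (v V) - D_V (v U) - v [U,V]. On two
    horizontal fields this is -v [hX,hY], which is the curvature of the Barthel
    connection ([h_curv_spray], [barthel_curvatureE]). On hX and JY it is D_hX
    JY - v [hX,JY], and a Christoffel argument identifies this difference with
    the tensor C'. It is symmetric because the Barthel connection has no
    torsion ([J_lie_horproj]); the metric condition and the definition of C'
    say that the sum of Omega (B(X,Y), Z) and Omega (B(X,Z), Y), where B is the
    difference, is twice Omega (C'(X,Y), Z); as C' is symmetric too, both
    trilinear forms are totally symmetric and equal ([Cp_berwald_difference]).

    Symmetry. Normality and the vanishing of the horizontal torsion add up to
    D_U (J V) - D_V (J U) = J [U,V] for all U and V ([D_torsionfree]). The
    Jacobi identity turns this into a first Bianchi identity without a torsion
    term for the K(U,V)(J W) ([bianchi]), and its value on hX, JY, hZ is the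
    symmetry P(X,Y)Z = P(Z,Y)X ([hv_curvC]).

    Skewness. D_hX is compatible with the metric Omega (J Y, Z) of the vertical
    bundle by assumption, and D_C is compatible with it by homogeneity, L_C
    Omega = Omega ([compatible_C]). Also by homogeneity [hX,C] is horizontal,
    so K(hX,C) = K(hX,J S) is skew for this metric ([curv_skew]). Hence Omega
    (P(X,S)Y, Z) is symmetric in X and Y and skew in Y and Z, and such a form
    is zero ([hv_curv_C]).

    These arguments take place in a Lie algebra of fields that acts on
    functions, with an endomorphism J and a field C that satisfy a few bracket
    relations. Coordinate calculus provides this algebra. The symmetry of
    second derivatives makes the bracket independent of the chart
    ([bracket_natural]) and yields the Jacobi identity ([bracket_jacobi]); the
    transition maps (x,y) |-> (phi x, Dphi(x) y) of the tangent bundle give J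
    and C the same expression in every chart ([local_Jform],
    [local_liouville]), from which their bracket relations are read off. *)

(** * Directional derivatives *)
Section DirectionalDerivatives.
Context {R : realType}.
Implicit Types U V W : normedModType R.

(** The difference of the two maps vanishes near x, hence is differentiable
    there with differential zero. *)
Lemma near_eq_differentiable V W (f g : V -> W) (x : V) :
  (\near x, f x = g x) -> differentiable f x -> differentiable g x.
Proof.
move=> fg df; have -> : g = f + (g - f) by rewrite addrC subrK.
apply: differentiableD => //; apply/diff_locallyP.
have gf0 : (g - f) \o shift x = cst ((g - f) x) + \0 +o_ 0 id.
  apply/eqaddoP => _/posnumP[e]; have fgx : f x = g x := nbhs_singleton fg.
  move: fg; rewrite (near_shift 0 x); apply: filterS => y /=;
    rewrite subr0 => fgy.
  by rewrite !fctE /= fgy fgx !subrr addr0 subrr normr0 mulr_ge0.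
have d0 : continuous (\0 : V -> W) by exact: cst_continuous.
by rewrite (@diff_unique _ _ _ _ \0).
Qed.

(** In coordinates a linear map is a finite sum of coordinate functions times
    constant vectors, so its differentiability, and with it its continuity, is
    that of the coordinates. *)
Lemma rV_linear_differentiable m W (L : {linear 'rV[R]_m -> W}) x :
  differentiable L x.
Proof.
have -> : (L : _ -> _) =
  \sum_(i < m) (fun v : 'rV_m => v 0 i *: L (delta_mx 0 i)).
  apply/funext => v; rewrite {1}(row_sum_delta v) linear_sum fct_sumE.
  by apply: eq_bigr => i _; rewrite linearZ.
by apply: differentiable_sum => i; apply/differentiableZl/differentiable_coord.
Qed.

Lemma rV_linear_continuous m W (L : {linear 'rV[R]_m -> W}) : continuous L.
Proof.
by move=> x; apply/differentiable_continuous/rV_linear_differentiable.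
Qed.

Lemma derive_linear m W (L : {linear 'rV[R]_m -> W}) x v : 'D_v L x = L v.
Proof.
rewrite deriveE; last exact: rV_linear_differentiable.
by rewrite diff_lin //; apply: rV_linear_continuous.
Qed.

Lemma derive_comp U V W (f : U -> V) (g : V -> W) x v :
  differentiable f x -> differentiable g (f x) ->
  'D_v (g \o f) x = 'D_('D_v f x) g (f x).
Proof.
move=> df dg; rewrite deriveE; last exact: differentiable_comp.
by rewrite diff_comp // !deriveE.
Qed.

(** Scalar multiplication is a continuous bilinear map, composed here with the
    pair (k, g). *)
Lemma is_diff_scale V W (k : V -> R^o) (g : V -> W) x :
  differentiable k x -> differentiable g x ->
  is_diff x (fun y => k y *: g y) (fun v => k x *: 'd g x v + 'd k x v *: g x).
Proof.
move=> dk dg.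
have scale_bilin : bilinear_for (GRing.Scale.Law.clone _ _ *:%R _)
    (GRing.Scale.Law.clone _ _ *:%R _) (@GRing.scale R W : R^o -> W -> W).
  split=> [u'|u] a y z /=; first by rewrite scalerDl scalerA.
  by rewrite scalerDr !scalerA mulrC.
pose scaleM := bilinear_isBilinear.Build R R^o W W _ _ _ scale_bilin.
pose scaleL : {bilinear R^o -> W -> W} :=
  HB.pack (@GRing.scale R W : R^o -> W -> W) scaleM.
have scalec : continuous (fun q : R^o * W => scaleL q.1 q.2).
  by move=> p; apply: scale_continuous.
have dkg : differentiable (fun y => (k y, g y)) x by exact: differentiable_pair.
have dscale : differentiable (fun q : R^o * W => scaleL q.1 q.2) (k x, g x).
  exact: differentiable_bilin.
have comp_scale : (fun y => k y *: g y) =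
  (fun q : R^o * W => scaleL q.1 q.2) \o (fun y => (k y, g y)) by [].
rewrite comp_scale; apply: DiffDef; first exact: differentiable_comp.
by rewrite diff_comp // diff_bilin // diff_pair.
Qed.

Lemma differentiable_scale V W (k : V -> R^o) (g : V -> W) x :
  differentiable k x -> differentiable g x ->
  differentiable (fun y => k y *: g y) x.
Proof. by move=> dk dg; have [] := is_diff_scale dk dg. Qed.

Lemma derive_dirB V W (f : V -> W) x u v : differentiable f x ->
  'D_(u - v) f x = 'D_u f x - 'D_v f x.
Proof. by move=> df; rewrite !deriveE // linearB. Qed.

Lemma derive_dirP V W (f : V -> W) x a u v : differentiable f x ->
  'D_(a *: u + v) f x = a *: 'D_u f x + 'D_v f x.
Proof. by move=> df; rewrite !deriveE // linearP. Qed.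

Lemma derive_funP V W (f g : V -> W) x a v :
  differentiable f x -> differentiable g x ->
  'D_v (a *: f + g) x = a *: 'D_v f x + 'D_v g x.
Proof.
move=> /diff_derivable df /diff_derivable dg.
by rewrite deriveD ?deriveZ //; exact: derivableZ.
Qed.

Lemma derive_row_sum W m (f : 'rV[R]_m -> W) x v : differentiable f x ->
  'D_v f x = \sum_i v 0 i *: 'D_(delta_mx 0 i) f x.
Proof.
move=> df; rewrite {1}(row_sum_delta v) deriveE // linear_sum.
by apply: eq_bigr => i _; rewrite linearZ deriveE.
Qed.

Lemma derive_scale V W (k : V -> R^o) (g : V -> W) x v :
  differentiable k x -> differentiable g x ->
  'D_v (fun y => k y *: g y) x = 'D_v k x *: g x + k x *: 'D_v g x.
Proof.
move=> dk dg; have [dkg dE] := is_diff_scale dk dg.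
by rewrite !deriveE // dE addrC.
Qed.

End DirectionalDerivatives.

(** * Maps of class C^k on an open set *)
Section Coordinate.
Context {R : realType} {m : nat}.

(** The codomain is R^o so that the coordinate is a linear map between normed
    modules. *)
Definition row_coord (i : 'I_m) (v : 'rV[R]_m) : R^o := v 0 i.

Fact row_coord_is_linear i : linear (row_coord i).
Proof. by move=> a u v; rewrite /row_coord !mxE. Qed.

HB.instance Definition _ i :=
  GRing.isLinear.Build R 'rV[R]_m R^o _ (row_coord i) (row_coord_is_linear i).

End Coordinate.

Section SmoothMaps.
Context {R : realType}.
Implicit Types V W : normedModType R.

Lemma open_near V (U : set V) (P : V -> Prop) x :
  open U -> U x -> (forall y, U y -> P y) -> \near x, P x.
Proof. by move=> oU Ux UP; apply: filterS (open_nbhs_nbhs (conj oU Ux)). Qed.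

Lemma Coo_differentiable V W (U : set V) (f : V -> W) x :
  Coo U f -> U x -> differentiable f x.
Proof. by move=> /(_ 1%N) [+ _]; apply. Qed.

Lemma Coo_derive V W (U : set V) (f : V -> W) w : Coo U f -> Coo U ('D_w f).
Proof. by move=> Uf k; have [_] := Uf k.+1; apply. Qed.

(** The product rule for C^(k+1) maps needs its factors to be C^k as well. *)
Lemma CkS V W k (U : set V) (f : V -> W) : Ck k.+1 U f -> Ck k U f.
Proof.
elim: k f => [|k IHk] f [df Df].
  by move=> x Ux; apply/differentiable_continuous/df.
by split=> // w; apply: IHk.
Qed.

Lemma eq_Ck V W k (U : set V) (f g : V -> W) : open U ->
  (forall x, U x -> f x = g x) -> Ck k U f -> Ck k U g.
Proof.
move=> oU; elim: k f g => [|k IHk] f g fg.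
  move=> cf x Ux; rewrite /prop_for /continuous_at -(fg x Ux).
  apply: cvg_trans (cf x Ux); apply: near_eq_cvg.
  by apply: (open_near oU Ux) => y /fg.
move=> [df Df]; split=> [x Ux|w].
  by apply: near_eq_differentiable (df x Ux); apply: (open_near oU Ux).
apply: IHk (Df w) => x Ux.
by apply: near_eq_derive; apply: (open_near oU Ux).
Qed.

Lemma Ck_cst V W k (U : set V) (c : W) : Ck k U (cst c).
Proof.
elim: k c => [|k IHk] c; first by move=> x _; apply: cst_continuous.
split=> [x _|w]; first exact: differentiable_cst.
have -> : 'D_w (cst c) = cst 0 :> (V -> W) by apply/funext => x;
  exact: derive_cst.
exact: IHk.
Qed.

Lemma CkD V W k (U : set V) (f g : V -> W) : open U ->
  Ck k U f -> Ck k U g -> Ck k U (f + g).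
Proof.
move=> oU; elim: k f g => [|k IHk] f g.
  by move=> cf cg x Ux; apply: continuousD; [apply: cf|apply: cg].
move=> [df Df] [dg Dg]; split=> [x Ux|w].
  by apply: differentiableD; [apply: df|apply: dg].
apply: eq_Ck (IHk _ _ (Df w) (Dg w)) => // x Ux.
by rewrite deriveD //; apply: diff_derivable; auto.
Qed.

Lemma Ck_scale V W k (U : set V) (a : V -> R^o) (f : V -> W) : open U ->
  Ck k U a -> Ck k U f -> Ck k U (fun x => a x *: f x).
Proof.
move=> oU; elim: k a f => [|k IHk] a f.
  by move=> ca cf x Ux; apply: continuousZ; [apply: ca|apply: cf].
move=> Ca Cf; have [[da Da] [df Df]] := (Ca, Cf).
split=> [x Ux|w].
  by apply: differentiable_scale; [apply: da|apply: df].
apply: eq_Ck (CkD oU (IHk _ _ (Da w) (CkS Cf)) (IHk _ _ (CkS Ca) (Df w))) => //.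
move=> x Ux; rewrite derive_scale; [by []|exact: da|exact: df].
Qed.

Lemma Ck_sum V W k (U : set V) n (f : 'I_n -> V -> W) : open U ->
  (forall i, Ck k U (f i)) -> Ck k U (\sum_i f i).
Proof.
move=> oU Cf; elim/big_ind: _ => [|g h Cg Ch|i _]; last exact: Cf.
- exact: Ck_cst.
- exact: CkD.
Qed.

Lemma Ck_linear_comp V W m k (U : set V) (L : {linear 'rV[R]_m -> W})
    (f : V -> 'rV[R]_m) : open U -> Ck k U f -> Ck k U (L \o f).
Proof.
move=> oU; elim: k f => [|k IHk] f.
  move=> cf x Ux; apply: continuous_comp; first exact: cf.
  exact: rV_linear_continuous.
move=> [df Df]; split=> [x Ux|w].
  by apply: differentiable_comp (df x Ux) _; apply: rV_linear_differentiable.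
apply: eq_Ck (IHk _ (Df w)) => // x Ux /=.
rewrite [RHS]derive_comp; first by rewrite derive_linear.
  exact: df.
exact: rV_linear_differentiable.
Qed.

Lemma Ck_comp_linear W m p k (U : set 'rV[R]_m) (U' : set 'rV[R]_p)
    (f : 'rV[R]_m -> W) (L : {linear 'rV[R]_p -> 'rV[R]_m}) : open U' ->
  (forall x, U' x -> U (L x)) -> Ck k U f -> Ck k U' (f \o L).
Proof.
move=> oU' U'U; elim: k f => [|k IHk] f.
  move=> cf x Ux; apply: continuous_comp; last exact/cf/U'U.
  exact: rV_linear_continuous.
move=> [df Df]; split=> [x Ux|w].
  apply: differentiable_comp (rV_linear_differentiable _ _) _.
  exact/df/U'U.
apply: eq_Ck (IHk _ (Df (L w))) => // x Ux /=.
rewrite [RHS]derive_comp; first by rewrite derive_linear.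
  exact: rV_linear_differentiable.
exact/df/U'U.
Qed.

Lemma Ck_linear W m k (U : set 'rV[R]_m) (L : {linear 'rV[R]_m -> W}) :
  Ck k U L.
Proof.
case: k => [|k]; first by move=> x _; exact: rV_linear_continuous.
split=> [x _|w]; first exact: rV_linear_differentiable.
have -> : 'D_w L = cst (L w) by apply/funext => x; rewrite derive_linear.
exact: Ck_cst.
Qed.

Lemma Ck_subset V W k (U U' : set V) (f : V -> W) :
  U' `<=` U -> Ck k U f -> Ck k U' f.
Proof.
move=> U'U; elim: k f => [|k IHk] f; first by move=> cf x /U'U; apply: cf.
move=> [df Df]; split=> [x Ux|w]; first by apply/df/U'U.
exact: (IHk _ (Df w)).
Qed.

(** The derivative along a moving direction is a combination of the partial
    derivatives with smooth coefficients. *)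
Lemma Coo_derive_along W m (U : set 'rV[R]_m) (f : 'rV[R]_m -> W) X : open U ->
  Coo U f -> Coo U X -> Coo U (fun x => 'D_(X x) f x).
Proof.
move=> oU Uf UX k.
have Csum : Ck k U (\sum_i (fun x => row_coord i (X x) *: 'D_(delta_mx 0 i) f
  x)).
  apply: Ck_sum => // i; apply: Ck_scale => //; last exact: Coo_derive.
  exact: (Ck_linear_comp (row_coord i) oU (UX k)).
apply: eq_Ck oU _ Csum => x Ux; rewrite fct_sumE [RHS]derive_row_sum //.
exact: Coo_differentiable Ux.
Qed.

End SmoothMaps.

(** * Symmetry of second derivatives *)

(* Second derivatives in different orders must not be compared by unfolding the
   limits that define them. *)
Local Opaque derive.

Section Schwarz.
Context {R : realType}.

Lemma is_derive_line (V : normedModType R) (f : V -> R^o) p v (s : R) :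
  differentiable f (p + s *: v) ->
  is_derive s 1 (fun t : R => f (p + t *: v) : R) ('D_v f (p + s *: v)).
Proof.
move=> df; pose line := (fun t : R => p + t *: v).
have [dline dlineE] : is_diff s line (fun t => t *: v).
  have -> : line = cst p + ( *:%R^~ v) by [].
  by apply: is_diff_eq; apply/funext => t /=; rewrite !fctE /= add0r.
apply: DeriveDef.
  apply: diff_derivable.
  exact: (differentiable_comp (f := line) (g := f) dline df).
have lineE : 'D_1 line s = v by rewrite deriveE // dlineE scale1r.
have := derive_comp (f := line) (g := f) 1 dline df.
by rewrite lineE.
Qed.


(** The mean value theorem, first along v for f(. + h w) - f, then along w for
    the derivative of f along v. The left-hand side is symmetric in v and w,
    which is how the two orders of differentiation get compared. *)
Lemma mixed_difference (V : normedModType R) (f : V ->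
  R^o) (x v w : V) (h : R) :
  0 < h ->
  (forall s t, s \in `[0, h] -> t \in `[0, h] ->
     differentiable f (x + s *: v + t *: w) /\
     differentiable ('D_v f) (x + s *: v + t *: w)) ->
  exists2 c : R * R, c.1 \in `[0, h] /\ c.2 \in `[0, h] &
    f (x + h *: v + h *: w) - (f (x + h *: v) + f (x + h *: w)) + f x =
    'D_w ('D_v f) (x + c.1 *: v + c.2 *: w) * h * h.
Proof.
move=> h0 df.
pose phi (s : R) : R := f (x + h *: w + s *: v) - f (x + s *: v).
pose dphi (s : R) : R := 'D_v f (x + s *: v + h *: w) - 'D_v f (x + s *: v).
have h0h : h \in `[0, h] by rewrite in_itv /= lexx ltW.
have z0h : 0 \in `[0, h] by rewrite in_itv /= lexx ltW.
have phi' (s : R) : s \in `[0, h] -> is_derive s 1 phi (dphi s).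
  move=> s0h; have [d1 _] := df _ _ s0h h0h; have [+ _] := df _ _ s0h z0h.
  rewrite scale0r addr0 => d2; rewrite /dphi addrAC.
  apply: is_deriveB; apply: is_derive_line => //.
  by rewrite addrAC.
have phic : {within `[0, h], continuous phi}.
  apply: derivable_within_continuous => s sh.
  exact: (@ex_derive _ _ _ _ _ _ _ (phi' s sh)).
have [c c0h] := MVT_segment (ltW h0)
  (fun s sh => phi' s (subset_itv_oo_cc sh)) phic.
rewrite subr0 /phi /dphi !scale0r !addr0 => phiE.
pose psi (t : R) : R := 'D_v f (x + c *: v + t *: w).
pose dpsi (t : R) : R := 'D_w ('D_v f) (x + c *: v + t *: w).
have psi' (t : R) : t \in `[0, h] -> is_derive t 1 psi (dpsi t).
  by move=> t0h; apply: is_derive_line; have [] := df _ _ c0h t0h.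
have psic : {within `[0, h], continuous psi}.
  apply: derivable_within_continuous => s sh.
  exact: (@ex_derive _ _ _ _ _ _ _ (psi' s sh)).
have [d d0h] := MVT_segment (ltW h0)
  (fun s sh => psi' s (subset_itv_oo_cc sh)) psic.
rewrite subr0 /psi scale0r addr0 => psiE.
exists (c, d) => //=; rewrite -[X in X * h]psiE -phiE.
rewrite [x + h *: w + _]addrAC; ring.
Qed.

(** Both second derivatives take the same value, the difference quotient of
    [mixed_difference], at points arbitrarily close to x; continuity brings the
    two equal values back to x. *)
Lemma Schwarz_scalar (V : normedModType R) (U : set V) (f : V -> R^o) x v w :
  open U -> Coo U f -> U x -> 'D_v ('D_w f) x = 'D_w ('D_v f) x.
Proof.
move=> oU Uf Ux.
have cont u1 u2 : {for x, continuous ('D_u1 ('D_u2 f))}.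
  apply: differentiable_continuous; apply: Coo_differentiable Ux.
  by do 2 apply: Coo_derive.
apply/eqP; rewrite -subr_eq0 -normr_le0; apply/ler_addgt0Pl => e e0.
rewrite addr0.
have e20 : 0 < e / 2 by rewrite divr_gt0.
have nU : \near x, U x by exact: open_nbhs_nbhs.
have /cvgrPdist_lt/(_ _ e20) n1 := cont v w.
have /cvgrPdist_lt/(_ _ e20) n2 := cont w v.
have [r /= r0 rP] := (nbhs_ballP _ _).1 (filterI nU (filterI n1 n2)).
pose h := r / (`|v| + `|w| + 1).
have n0 : 0 < `|v| + `|w| + 1 by rewrite ltr_wpDl // addr_ge0.
have h0 : 0 < h by rewrite divr_gt0.
have Pst (s t : R) : s \in `[0, h] -> t \in `[0, h] -> 
  [/\ U (x + s *: v + t *: w),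
      `|'D_v ('D_w f) x - 'D_v ('D_w f) (x + s *: v + t *: w)| < e / 2 &
      `|'D_w ('D_v f) x - 'D_w ('D_v f) (x + s *: v + t *: w)| < e / 2].
  rewrite !in_itv /= => /andP[s0 sh] /andP[t0 th].
  suff /rP[Uy [d1 d2]] : ball x r (x + s *: v + t *: w) by exact: And3 Uy d1 d2.
  rewrite -ball_normE /= -addrA opprD addNKr normrN.
  rewrite (le_lt_trans (ler_normD _ _)) // !normrZ !ger0_norm //.
  rewrite (@le_lt_trans _ _ (h * (`|v| + `|w|))) //.
    by rewrite mulrDr lerD // ler_wpM2r.
  by rewrite mulrAC ltr_pdivrMr // ltr_pM2l // ltrDl.
have [||[c d] /= [ch dh] E1] := @mixed_difference V f x v w h => //.
  move=> s t sh th; have [Uy _ _] := Pst _ _ sh th.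
  by split; apply: (Coo_differentiable _ Uy) => //; exact: Coo_derive.
have [||[c' d'] /= [ch' dh'] E2] := @mixed_difference V f x w v h => //.
  move=> s t sh th; rewrite addrAC; have [Uy _ _] := Pst _ _ th sh.
  by split; apply: (Coo_differentiable _ Uy) => //; exact: Coo_derive.
have [_ _ dist1] := Pst _ _ ch dh; have [_ dist2 _] := Pst _ _ dh' ch'.
rewrite [x + h *: w + _]addrAC [f (x + h *: w) + _]addrC in E2.
rewrite [x + c' *: w + _]addrAC in E2.
have hn0 : h != 0 by rewrite gt_eqF.
have /(mulIf hn0)/(mulIf hn0) E := etrans (esym E1) E2.
rewrite -{}E in dist2.
rewrite (le_trans (ler_distD ('D_w ('D_v f) (x + c *: v + d *: w)) _ _)) //.
rewrite [leRHS]splitr [X in _ + X <= _]distrC.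
exact: lerD (ltW dist2) (ltW dist1).
Qed.

Lemma Schwarz_row (V : normedModType R) m (U : set V) (f : V ->
  'rV[R]_m) x v w :
  open U -> Coo U f -> U x -> 'D_v ('D_w f) x = 'D_w ('D_v f) x.
Proof.
move=> oU Uf Ux; apply/rowP => i.
have coordE (g : V -> 'rV[R]_m) u y : Coo U g -> U y ->
    'D_u g y 0 i = 'D_u (row_coord i \o g) y.
  move=> Ug Uy; rewrite [RHS]derive_comp; first by rewrite derive_linear.
    exact: Coo_differentiable Uy.
  exact: rV_linear_differentiable.
have Uif : Coo U (row_coord i \o f) by move=> k; apply: Ck_linear_comp.
have coordE2 u1 u2 : 'D_u1 ('D_u2 f) x 0 i = 'D_u1 ('D_u2 (row_coord i \o f)) x.
  rewrite coordE //; last exact: Coo_derive.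
  by apply: near_eq_derive; apply: (open_near oU Ux) => y Uy; rewrite -coordE.
exact: etrans (coordE2 v w)
  (etrans (Schwarz_scalar v w oU Uif Ux) (esym (coordE2 w v))).
Qed.

(** Differentiating D_X f along v differentiates either the direction X or the
    function f: the rule behind all bracket computations below. *)
Lemma derive_along (W : normedModType R) m (f : 'rV[R]_m -> W)
    (X : 'rV[R]_m -> 'rV[R]_m) U x v : open U -> Coo U f -> Coo U X -> U x ->
  'D_v (fun y => 'D_(X y) f y) x = 'D_('D_v X x) f x + 'D_v ('D_(X x) f) x.
Proof.
move=> oU Uf UX Ux.
have dX : differentiable X x := Coo_differentiable UX Ux.
have dDf u : differentiable ('D_u f) x.
  by apply: Coo_differentiable Ux; exact: Coo_derive.
have expand (Y : 'rV[R]_m -> 'rV[R]_m) : differentiable Y x ->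
    'D_v (fun y => 'D_(Y y) f y) x =
    \sum_i ('D_v Y x 0 i *: 'D_(delta_mx 0 i) f x +
            Y x 0 i *: 'D_v ('D_(delta_mx 0 i) f) x).
  move=> dY.
  have dYi i : differentiable (row_coord i \o Y) x.
    by apply: differentiable_comp => //; exact: rV_linear_differentiable.
  have -> : 'D_v (fun y => 'D_(Y y) f y) x =
      'D_v (\sum_i (fun y => row_coord i (Y y) *: 'D_(delta_mx 0 i) f y)) x.
    apply: near_eq_derive; apply: (open_near oU Ux) => y Uy.
    by rewrite fct_sumE derive_row_sum //; exact: Coo_differentiable Uy.
  rewrite derive_sum; last first.
    move=> i; apply: diff_derivable.
    exact: (differentiable_scale (dYi i) (dDf _)).
  apply: eq_bigr => i _; rewrite (derive_scale _ (dYi i) (dDf _)).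
  congr (_ *: _ + _).
  rewrite [LHS]derive_comp ?derive_linear //.
  exact: rV_linear_differentiable.
rewrite expand // big_split /= -derive_row_sum;
  last exact: Coo_differentiable Ux.
congr (_ + _).
rewrite (expand (cst (X x))); last exact: differentiable_cst.
rewrite big_split /= [X in _ = X + _]big1 ?add0r // => i _.
by rewrite derive_cst mxE scale0r.
Qed.

End Schwarz.

(** * Fields and functions in an atlas with smooth transitions *)
Local Opaque derivable.

(** If X' and Y' are the images of X and Y under phi, then [X',Y'] is the image
    of [X,Y]: the two derivatives of Dphi agree by symmetry and cancel. *)
Lemma bracket_natural (R : realType) m (U : set 'rV[R]_m)
    (phi X Y X' Y' : 'rV[R]_m -> 'rV[R]_m) z :
  open U -> Coo U phi -> Coo U X -> Coo U Y -> U z ->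
  differentiable X' (phi z) -> differentiable Y' (phi z) ->
  (forall w, U w -> X' (phi w) = 'D_(X w) phi w) ->
  (forall w, U w -> Y' (phi w) = 'D_(Y w) phi w) ->
  'D_('D_(X z) Y z - 'D_(Y z) X z) phi z =
  'D_(X' (phi z)) Y' (phi z) - 'D_(Y' (phi z)) X' (phi z).
Proof.
move=> oU Uphi UX UY Uz dX' dY' XX' YY'.
have dphi := Coo_differentiable Uphi Uz.
have rule V W W' : Coo U W -> differentiable W' (phi z) ->
    (forall w, U w -> W' (phi w) = 'D_(W w) phi w) ->
    'D_('D_V phi z) W' (phi z) =
    'D_('D_V W z) phi z + 'D_V ('D_(W z) phi) z.
  move=> UW dW' WW'; rewrite -(derive_along V oU Uphi UW Uz).
  rewrite -(derive_comp V dphi dW').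
  by apply: near_eq_derive; apply: (open_near oU Uz) => w Uw; rewrite -WW'.
apply/esym; rewrite (XX' z Uz) (YY' z Uz).
rewrite (rule (X z) Y Y' UY dY' YY').
rewrite (rule (Y z) X X' UX dX' XX').
rewrite (derive_dirB _ _ dphi).
rewrite (Schwarz_row (X z) (Y z) oU Uphi Uz) [X in _ - X]addrC.
exact: addrKA.
Qed.

(** Expanding the nested brackets with [derive_along], the terms with a second
    derivative cancel by symmetry and those with two first derivatives cancel
    in pairs. *)
Lemma bracket_jacobi (R : realType) m (U : set 'rV[R]_m)
    (X Y Z : 'rV[R]_m -> 'rV[R]_m) p :
  let bracket (V W : 'rV[R]_m -> 'rV[R]_m) w :=
    'D_(V w) W w - 'D_(W w) V w in
  open U -> Coo U X -> Coo U Y -> Coo U Z -> U p ->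
  bracket X (bracket Y Z) p =
  bracket (bracket X Y) Z p + bracket Y (bracket X Z) p.
Proof.
move=> bracket oU UX UY UZ Up; rewrite {}/bracket /=.
have dX := Coo_differentiable UX Up; have dY := Coo_differentiable UY Up.
have dZ := Coo_differentiable UZ Up.
have expand V W v : Coo U V -> Coo U W ->
    'D_v (fun w => 'D_(V w) W w - 'D_(W w) V w) p =
    ('D_('D_v V p) W p + 'D_v ('D_(V p) W) p) -
    ('D_('D_v W p) V p + 'D_v ('D_(W p) V) p).
  move=> UV UW.
  rewrite -(derive_along v oU UW UV Up) -(derive_along v oU UV UW Up).
  have dVW := Coo_differentiable (Coo_derive_along oU UV UW) Up.
  have dWV := Coo_differentiable (Coo_derive_along oU UW UV) Up.
  exact: (deriveB (diff_derivable dWV) (diff_derivable dVW)).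
pose sub u v : 'rV[R]_m := u - v.
apply: etrans (congr2 sub (expand Y Z (X p) UY UZ) (derive_dirB _ _ dX)) _.
apply/esym/(etrans (congr2 +%R
  (congr2 sub (derive_dirB _ _ dZ) (expand X Y (Z p) UX UY))
  (congr2 sub (expand X Z (Y p) UX UZ) (derive_dirB _ _ dY)))).
rewrite {}/sub.
rewrite (Schwarz_row (X p) (Y p) oU UZ Up) (Schwarz_row (X p) (Z p) oU UY Up).
rewrite (Schwarz_row (Y p) (Z p) oU UX Up).
move: ('D_('D_(X p) Y p) Z p) => t1; move: ('D_('D_(X p) Z p) Y p) => t2.
move: ('D_('D_(Y p) X p) Z p) => t3; move: ('D_('D_(Y p) Z p) X p) => t4.
move: ('D_('D_(Z p) X p) Y p) => t5; move: ('D_('D_(Z p) Y p) X p) => t6.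
move: ('D_(Y p) ('D_(X p) Z) p) => s1; move: ('D_(Z p) ('D_(X p) Y) p) => s2.
move: ('D_(Z p) ('D_(Y p) X) p) => s3.
by apply/rowP => i; rewrite !mxE; ring.
Qed.

(** What the calculus of fields needs from an atlas, stated without a topology
    on the points: it applies to the slit tangent bundle through the topology
    of R^(2n) alone. *)
Record smooth_atlas (R : realType) m N (A : atlas R m N) : Prop := SmoothAtlas {
  dom_chart_at_self : forall p, dom (chart_at A p) p;
  coord_injective : forall (a : chart A) p q,
    dom a p -> dom a q -> coord a p = coord a q -> p = q;
  overlap_open : forall a b : chart A, open (coord a @` (dom a `&` dom b));
  overlap_smooth : forall a b : chart A,
    Coo (coord a @` (dom a `&` dom b)) (transition a b) }.

Arguments dom_chart_at_self {R m N A} _ p.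
Arguments overlap_open {R m N A} _ a b.
Arguments overlap_smooth {R m N A} _ a b.

Lemma local_expr_coord (R : realType) m N (A : atlas R m N)
    (W : normedModType R) (a : chart A) (f : N -> W) p :
  (forall q, dom a q -> coord a q = coord a p -> q = p) -> dom a p ->
  local_expr a f (coord a p) = f p.
Proof.
move=> inj ap; rewrite /local_expr; case: xgetP => [_ -> [q /= [aq qp] <-]|].
  by rewrite (inj q).
by move=> /(_ (f p)) []; exists p.
Qed.

Section AtlasCalculus.
Context {R : realType} {m : nat} {N : Type} (A : atlas R m N).
Hypothesis hA : smooth_atlas A.
Implicit Types (a b : chart A) (X Y Z : @field R m N) (f g : N -> R).

Lemma local_exprE (W : normedModType R) a (f : N -> W) p :
  dom a p -> local_expr a f (coord a p) = f p.
Proof.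
move=> ap; apply: local_expr_coord => // q aq.
exact: (coord_injective hA aq ap).
Qed.

Lemma chart_image_open a : open (chart_image a).
Proof. by have := overlap_open hA a a; rewrite setIid. Qed.

Arguments chart_image_open : clear implicits.

Lemma transitionE a b p : dom a p -> transition a b (coord a p) = coord b p.
Proof. exact: local_exprE. Qed.

Lemma near_overlap a b p (P : 'rV[R]_m -> Prop) : dom a p -> dom b p ->
  (forall q, dom a q -> dom b q -> P (coord a q)) ->
  \forall z \near coord a p, P z.
Proof.
move=> ap bp abP; apply: (open_near (overlap_open hA a b)); first by exists p.
by move=> _ [q [aq bq] <-]; apply: abP.
Qed.

Lemma near_chart a p (P : 'rV[R]_m -> Prop) : dom a p ->
  (forall q, dom a q -> P (coord a q)) ->
  \forall z \near coord a p, P z.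
Proof. by move=> ap aP; apply: (near_overlap ap ap) => q aq _; apply: aP. Qed.

Lemma transition_differentiable a b p : dom a p -> dom b p ->
  differentiable (transition a b) (coord a p).
Proof.
by move=> ap bp; apply: Coo_differentiable (overlap_smooth hA a b) _; exists p.
Qed.

(** The chain rule for the cocycle condition on the preferred chart at p, a and
    b. *)
Lemma components_transition a b p v : dom a p -> dom b p ->
  components b p v = 'D_(components a p v) (transition a b) (coord a p).
Proof.
move=> ap bp; have cp := dom_chart_at_self hA p; rewrite /components.
move: (chart_at A p) cp => c cp.
have dca := transition_differentiable cp ap.
have dab : differentiable (transition a b) (transition c a (coord c p)).
  by rewrite (transitionE a cp); exact: transition_differentiable.
have := derive_comp v dca dab; rewrite (transitionE a cp) => <-.
apply: near_eq_derive; apply: (near_overlap cp ap) => q cq aq /=.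
by rewrite !transitionE.
Qed.

Lemma components_chart_at p v : components (chart_at A p) p v = v.
Proof.
have cp := dom_chart_at_self hA p; rewrite /components.
rewrite (near_eq_derive (g := id)) ?derive_id //.
by apply: (near_chart cp) => q cq; rewrite transitionE.
Qed.

Lemma local_fieldE a X p : dom a p ->
  local_field a X (coord a p) = components a p (X p).
Proof. exact: local_exprE. Qed.

Local Opaque local_expr local_field transition.

Lemma local_field_chart_at X p :
  local_field (chart_at A p) X (coord (chart_at A p) p) = X p.
Proof.
by rewrite local_fieldE ?components_chart_at //; exact: dom_chart_at_self.
Qed.

Lemma local_field_transition a b X p : dom a p -> dom b p ->
  local_field b X (coord b p) =
  'D_(local_field a X (coord a p)) (transition a b) (coord a p).
Proof.
move=> ap bp; rewrite (local_fieldE X ap) (local_fieldE X bp).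
exact: components_transition.
Qed.

Lemma smooth_field_differentiable X a p : smooth_field A X -> dom a p ->
  differentiable (local_field a X) (coord a p).
Proof. by move=> sX ap; apply: Coo_differentiable (sX a) _; exists p. Qed.

Lemma smooth_fun_Coo f a : smooth_fun A f ->
  Coo (chart_image a) (local_expr a (f : N -> R^o)).
Proof. by move=> sf k; apply: sf. Qed.

Lemma smooth_fun_differentiable f a p : smooth_fun A f -> dom a p ->
  differentiable (local_expr a (f : N -> R^o)) (coord a p).
Proof.
by move=> sf ap; apply: Coo_differentiable (smooth_fun_Coo a sf) _; exists p.
Qed.

(** The bracket is defined at each point through the preferred chart of that
    point; [bracket_natural] shows that any chart computes it, which is what
    iterated brackets require. *)
Lemma local_lie X Y a p : smooth_field A X -> smooth_field A Y -> dom a p ->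
  local_field a (lie A X Y) (coord a p) =
  'D_(local_field a X (coord a p)) (local_field a Y) (coord a p) -
  'D_(local_field a Y (coord a p)) (local_field a X) (coord a p).
Proof.
move=> sX sY ap; have bp := dom_chart_at_self hA p.
rewrite local_fieldE // /components /lie.
have oba := overlap_open hA (chart_at A p) a.
have sba := overlap_smooth hA (chart_at A p) a.
have sub_ba : coord (chart_at A p) @` (dom (chart_at A p) `&` dom a)
    `<=` chart_image (chart_at A p) by move=> _ [q [bq _] <-]; exists q.
have restr Z : smooth_field A Z ->
    Coo (coord (chart_at A p) @` (dom (chart_at A p) `&` dom a))
      (local_field (chart_at A p) Z).
  by move=> sZ k; apply: Ck_subset sub_ba (sZ _ k).
have dif Z : smooth_field A Z -> differentiable (local_field a Z)
    (transition (chart_at A p) a (coord (chart_at A p) p)).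
  by move=> sZ; rewrite (transitionE _ bp); exact: smooth_field_differentiable.
have rule Z w : (coord (chart_at A p) @` (dom (chart_at A p) `&` dom a)) w ->
    local_field a Z (transition (chart_at A p) a w) =
    'D_(local_field (chart_at A p) Z w) (transition (chart_at A p) a) w.
  by move=> [q [bq aq] <-];
    rewrite (transitionE _ bq) (local_field_transition Z bq aq).
have pab : (coord (chart_at A p) @` (dom (chart_at A p) `&` dom a))
    (coord (chart_at A p) p) by exists p.
have := bracket_natural oba sba (restr X sX) (restr Y sY) pab (dif X sX)
  (dif Y sY) (rule X) (rule Y).
by rewrite (transitionE _ bp) !local_field_chart_at.
Qed.

Lemma local_act X f a p : smooth_fun A f -> dom a p ->
  local_expr a (act A X f : N -> R^o) (coord a p) =
  'D_(local_field a X (coord a p)) (local_expr a (f : N -> R^o)) (coord a p).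
Proof.
move=> sf ap; have bp := dom_chart_at_self hA p.
rewrite local_exprE // /act (local_field_transition X bp ap)
  local_field_chart_at.
move: (chart_at A p) bp => b bp.
have dba := transition_differentiable bp ap.
have df : differentiable (local_expr a (f : N ->
  R^o)) (transition b a (coord b p)).
  by rewrite (transitionE a bp); exact: smooth_fun_differentiable.
have := derive_comp (X p) dba df; rewrite (transitionE a bp) => <-.
apply: near_eq_derive; apply: (near_overlap bp ap) => q bq aq /=.
by rewrite transitionE // !local_exprE.
Qed.

Lemma smooth_lie X Y : smooth_field A X -> smooth_field A Y ->
  smooth_field A (lie A X Y).
Proof.
move=> sX sY a k; have oa := chart_image_open a.
have CXY := Coo_derive_along oa (sY a) (sX a) k.
have CYX := Coo_derive_along oa (sX a) (sY a) k.
apply: (eq_Ck oa _ (CkD oa CXY (Ck_scale oa (Ck_cst k _ (-1 : R^o)) CYX))).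
by move=> _ [p ap <-]; rewrite local_lie // !fctE /= scaleN1r.
Qed.

Lemma smooth_act X f : smooth_field A X -> smooth_fun A f ->
  smooth_fun A (act A X f).
Proof.
move=> sX sf k a; have oa := chart_image_open a.
have CXf := Coo_derive_along oa (smooth_fun_Coo a sf) (sX a) k.
by apply: (eq_Ck oa _ CXf) => _ [p ap <-]; rewrite local_act.
Qed.

Lemma local_fieldP a c X Y p : dom a p ->
  local_field a (c *: X + Y) (coord a p) =
  c *: local_field a X (coord a p) + local_field a Y (coord a p).
Proof.
move=> ap; rewrite !local_fieldE // /components.
have dcp := transition_differentiable (dom_chart_at_self hA p) ap.
exact: (derive_dirP c (X p) (Y p) dcp).
Qed.

Lemma smooth_fieldP c X Y : smooth_field A X -> smooth_field A Y ->
  smooth_field A (c *: X + Y).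
Proof.
move=> sX sY a k; have oa := chart_image_open a.
apply: (eq_Ck oa _ (CkD oa (Ck_scale oa (Ck_cst k _ (c : R^o)) (sX a k)) (sY a
  k))).
by move=> _ [p ap <-]; rewrite local_fieldP.
Qed.

Lemma local_exprP a c f g p : dom a p ->
  local_expr a (c *: (f : N -> R^o) + g) (coord a p) =
  c *: local_expr a (f : N -> R^o) (coord a p) +
  local_expr a (g : N -> R^o) (coord a p).
Proof. by move=> ap; rewrite !local_exprE. Qed.

Lemma smooth_funP c f g : smooth_fun A f -> smooth_fun A g ->
  smooth_fun A (c *: (f : N -> R^o) + g).
Proof.
move=> sf sg k a; have oa := chart_image_open a.
apply: (eq_Ck oa _ (CkD oa (Ck_scale oa (Ck_cst k _ (c : R^o)) (sf k a)) (sg k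
  a))).
by move=> _ [p ap <-]; rewrite local_exprP.
Qed.

Lemma smooth_field0 : smooth_field A 0.
Proof.
move=> a k; apply: (eq_Ck (chart_image_open a) _ (Ck_cst k _ 0)).
move=> _ [p ap <-]; rewrite local_fieldE //= /components.
exact/esym/derive0.
Qed.

Lemma smooth_fun0 : smooth_fun A (0 : N -> R^o).
Proof.
move=> k a; apply: (eq_Ck (chart_image_open a) _ (Ck_cst k _ 0)).
by move=> _ [p ap <-]; rewrite local_exprE.
Qed.

Lemma lieC X Y : lie A X Y = - lie A Y X.
Proof. by apply/funext => p; rewrite !fctE /lie opprB. Qed.

Lemma derive_local_fieldP c X Y a p v : smooth_field A X -> smooth_field A Y ->
  dom a p -> 'D_v (local_field a (c *: X + Y)) (coord a p) =
  c *: 'D_v (local_field a X) (coord a p) + 'D_v (local_field a Y) (coord a p).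
Proof.
move=> sX sY ap.
have := derive_funP c v (smooth_field_differentiable sX ap)
                    (smooth_field_differentiable sY ap).
move=> <-; apply: near_eq_derive; apply: (near_chart ap) => q aq.
exact: local_fieldP.
Qed.

Lemma lieP c X Y Z : smooth_field A X -> smooth_field A Y -> smooth_field A Z ->
  lie A (c *: X + Y) Z = c *: lie A X Z + lie A Y Z.
Proof.
move=> sX sY sZ; apply/funext => p; have ap := dom_chart_at_self hA p.
have dZ := smooth_field_differentiable sZ ap.
have E1 := derive_dirP c (X p) (Y p) dZ.
have E2 := derive_local_fieldP c (Z p) sX sY ap.
apply: etrans (congr2 (fun u v => u - v) E1 E2) _.
by rewrite opprD addrACA -scalerBr.
Qed.

Lemma actP c X f g : smooth_fun A f -> smooth_fun A g ->
  act A X (c *: (f : N -> R^o) + g) = c *: (act A X f : N -> R^o) + act A X g.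
Proof.
move=> sf sg; apply/funext => p; have ap := dom_chart_at_self hA p.
have := derive_funP c (X p) (smooth_fun_differentiable sf ap)
                        (smooth_fun_differentiable sg ap).
rewrite !fctE /act => <-.
by apply: near_eq_derive; apply: (near_chart ap) => q aq; exact: local_exprP.
Qed.

Lemma act_fieldP c X Y f : smooth_fun A f ->
  act A (c *: X + Y) f = c *: (act A X f : N -> R^o) + act A Y f.
Proof.
move=> sf; apply/funext => p; have ap := dom_chart_at_self hA p.
exact: (derive_dirP c (X p) (Y p) (smooth_fun_differentiable sf ap)).
Qed.

(** In the chart, act X (act Y f) is the derivative along D_X Y plus a
    symmetric second derivative. *)
Lemma act_lie X Y f : smooth_field A X -> smooth_field A Y -> smooth_fun A f ->
  act A (lie A X Y) f = act A X (act A Y f) - act A Y (act A X f).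
Proof.
move=> sX sY sf; apply/funext => p; have ap := dom_chart_at_self hA p.
have aap : chart_image (chart_at A p) (coord (chart_at A p) p) by exists p.
have oa := chart_image_open (chart_at A p).
have Cf := smooth_fun_Coo (chart_at A p) sf.
have second V Z : smooth_field A Z -> act A V (act A Z f) p =
    'D_('D_(V p) (local_field (chart_at A p) Z) (coord (chart_at A p) p))
      (local_expr (chart_at A p) (f : N -> R^o)) (coord (chart_at A p) p) +
    'D_(V p) ('D_(Z p) (local_expr (chart_at A p) (f : N -> R^o)))
      (coord (chart_at A p) p).
  move=> sZ; have := derive_along (V p) oa Cf (sZ _) aap.
  rewrite local_field_chart_at => <-.
  by apply: near_eq_derive; apply: (near_chart ap) => q aq; exact: local_act.
apply/esym/(etrans (congr2 (fun u v => u - v) (second X Y sY) (second Y X sX))).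
rewrite (Schwarz_scalar (X p) (Y p) oa Cf aap) [X in _ - X = _]addrC addrKA.
exact/esym/(derive_dirB _ _ (smooth_fun_differentiable sf ap)).
Qed.

Lemma lie_jacobi X Y Z :
  smooth_field A X -> smooth_field A Y -> smooth_field A Z ->
  lie A X (lie A Y Z) = lie A (lie A X Y) Z + lie A Y (lie A X Z).
Proof.
move=> sX sY sZ; apply/funext => p; have ap := dom_chart_at_self hA p.
have aap : chart_image (chart_at A p) (coord (chart_at A p) p) by exists p.
have := bracket_jacobi (chart_image_open (chart_at A p)) (sX _) (sY _) (sZ _)
  aap.
rewrite /= !local_field_chart_at => jacobi.
have derive_lie V W v : smooth_field A V -> smooth_field A W ->
    'D_v (local_field (chart_at A p) (lie A V W)) (coord (chart_at A p) p) =
    'D_v (fun w =>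
      'D_(local_field (chart_at A p) V w) (local_field (chart_at A p) W) w -
      'D_(local_field (chart_at A p) W w) (local_field (chart_at A p) V) w)
      (coord (chart_at A p) p).
  move=> sV sW; apply: near_eq_derive.
  by apply: (near_chart ap) => q aq; exact: local_lie.
pose sub u v : 'rV[R]_m := u - v.
apply: etrans (congr2 sub (derive_lie Y Z (X p) sY sZ) erefl) _.
apply: etrans jacobi (esym _).
exact: (congr2 +%R (congr2 sub erefl (derive_lie X Y (Z p) sX sY))
                   (congr2 sub (derive_lie X Z (Y p) sX sZ) erefl)).
Qed.

Lemma lieBr X Y Z : smooth_field A X -> smooth_field A Y -> smooth_field A Z ->
  lie A X (Y - Z) = lie A X Y - lie A X Z.
Proof.
move=> sX sY sZ.
have YZ : Y - Z = (-1) *: Z + Y by rewrite scaleN1r addrC.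
apply: etrans (lieC X (Y - Z)) _.
apply: etrans (congr1 (fun V => - lie A V X) YZ) _.
apply: etrans (congr1 -%R (lieP (-1) sZ sY sX)) _.
pose sub (V W : N -> 'rV[R]_m) := V - W.
apply: etrans _ (congr2 sub (esym (lieC X Y)) (esym (lieC X Z))).
rewrite /sub; move: (lie A Y X) (lie A Z X) => V W.
by rewrite scaleN1r opprD addrC.
Qed.

Lemma actB X f g : smooth_fun A f -> smooth_fun A g ->
  act A X ((f : N -> R^o) - g) = (act A X f : N -> R^o) - act A X g.
Proof.
move=> sf sg.
have fg : (f : N -> R^o) - g = (-1) *: (g : N -> R^o) + f.
  by rewrite scaleN1r addrC.
apply: etrans (congr1 (act A X) fg) _.
apply: etrans (actP (-1) X sg sf) _.
move: (act A X f : N -> R^o) (act A X g : N -> R^o) => F G.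
by rewrite scaleN1r addrC.
Qed.

Lemma act_fieldD X Y f : smooth_fun A f ->
  act A (X + Y) f = (act A X f : N -> R^o) + act A Y f.
Proof.
move=> sf; have XY : X + Y = 1 *: X + Y by rewrite scale1r.
apply: etrans (congr1 (fun V => act A V f) XY) _.
apply: etrans (act_fieldP 1 X Y sf) _.
by move: (act A X f : N -> R^o) => F; rewrite scale1r.
Qed.

End AtlasCalculus.

Arguments chart_image_open {R m N A} hA a.

(** * The slit tangent bundle *)
Section Blocks.
Context {R : realType} {n : nat}.

Definition base_row (v : 'rV[R]_n) : 'rV[R]_(n + n) := row_mx v 0.

Definition fibre_row (v : 'rV[R]_n) : 'rV[R]_(n + n) := row_mx 0 v.

Fact base_row_is_linear : linear base_row.
Proof.
by move=> a u v; rewrite /base_row scale_row_mx add_row_mx scaler0 addr0.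
Qed.

Fact fibre_row_is_linear : linear fibre_row.
Proof.
by move=> a u v; rewrite /fibre_row scale_row_mx add_row_mx scaler0 addr0.
Qed.

HB.instance Definition _ :=
  GRing.isLinear.Build R 'rV[R]_n 'rV[R]_(n + n) _ base_row base_row_is_linear.

HB.instance Definition _ :=
  GRing.isLinear.Build R 'rV[R]_n 'rV[R]_(n + n) _ fibre_row
    fibre_row_is_linear.

Lemma lsubmx_fibre_row v : lsubmx (fibre_row v) = 0.
Proof. exact: row_mxKl. Qed.
Lemma rsubmx_fibre_row v : rsubmx (fibre_row v) = v.
Proof. exact: row_mxKr. Qed.
Lemma lsubmx_base_row v : lsubmx (base_row v) = v. Proof. exact: row_mxKl. Qed.
Lemma base_fibre_row u v : base_row u + fibre_row v = row_mx u v.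
Proof. by rewrite /base_row /fibre_row add_row_mx addr0 add0r. Qed.

Lemma lsubmxB (u v : 'rV[R]_(n + n)) : lsubmx (u - v) = lsubmx u - lsubmx v.
Proof. exact: linearB. Qed.

Lemma fibre_rowB u v : fibre_row (u - v) = fibre_row u - fibre_row v.
Proof. exact: linearB. Qed.

Lemma fibre_row_subr w v : fibre_row (lsubmx (w - fibre_row v)) =
  fibre_row (lsubmx w).
Proof. by rewrite lsubmxB lsubmx_fibre_row subr0. Qed.

Lemma fibre_row_subl w v : fibre_row (lsubmx (fibre_row v - w)) =
  - fibre_row (lsubmx w).
Proof. by rewrite lsubmxB lsubmx_fibre_row sub0r linearN. Qed.

End Blocks.

(** The derivative of a tangent transition map is needed on the fibre
    directions and modulo them only; both follow by writing its fibre component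
    as the derivative of the pulled-back map along the field (x,y) |->
    (y,0). *)
Section TangentTransition.
Context {R : realType} {n : nat} (phi : 'rV[R]_n ->
  'rV[R]_n) (U : set 'rV[R]_n).
Hypotheses (oU : open U) (sphi : Coo U phi).

Definition tangent_map (w : 'rV[R]_(n + n)) : 'rV[R]_(n + n) :=
  row_mx (phi (lsubmx w)) ('D_(rsubmx w) phi (lsubmx w)).

Let pullback (w : 'rV[R]_(n + n)) := phi (lsubmx w).

Definition nonzero_over : set 'rV[R]_(n + n) :=
  [set w | U (lsubmx w) /\ rsubmx w != 0].

Lemma nonzero_over_open : open nonzero_over.
Proof.
apply: openI.
  by apply: open_comp oU => w _; exact: continuous_lsubmx.
rewrite [X in open X](_ : _ = rsubmx @^-1` (~` [set 0])); last first.
  by apply/seteqP; split=> w /= /eqP.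
apply: open_comp => [w _|]; first exact: continuous_rsubmx.
rewrite openC; apply/accessible_closed_set1/hausdorff_accessible.
exact: norm_hausdorff.
Qed.

Let pullback_smooth : Coo nonzero_over pullback.
Proof.
move=> k; apply: (@Ck_comp_linear _ _ _ _ _ _ _ phi lsubmx nonzero_over_open _
  (sphi k)).
by move=> w [].
Qed.

Let derive_pullback w v : nonzero_over w ->
  'D_v pullback w = 'D_(lsubmx v) phi (lsubmx w).
Proof.
move=> [Uw _]; have dl := rV_linear_differentiable (@lsubmx R 1 n n) w.
have := derive_comp (g := phi) v dl (Coo_differentiable sphi Uw).
by rewrite derive_linear.
Qed.

Let tautological := base_row \o (@rsubmx R 1 n n).

Let tangent_mapE w : nonzero_over w ->
  tangent_map w = base_row (pullback w) + fibre_row ('D_(tautological w)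
    pullback w).
Proof.
move=> Uw; rewrite base_fibre_row; congr row_mx; apply/esym.
by apply: etrans (derive_pullback (tautological w) Uw) _;
  rewrite lsubmx_base_row.
Qed.

Let vertical_part_smooth : Coo nonzero_over (fun w => 'D_(tautological w)
  pullback w).
Proof.
apply: (Coo_derive_along nonzero_over_open pullback_smooth) => k;
  exact: Ck_linear.
Qed.

Lemma tangent_map_smooth : Coo nonzero_over tangent_map.
Proof.
move=> k; have oN := nonzero_over_open.
have C1 := Ck_linear_comp base_row oN (pullback_smooth k).
have C2 := Ck_linear_comp fibre_row oN (vertical_part_smooth k).
by apply: (eq_Ck oN _ (CkD oN C1 C2)) => w Uw; rewrite tangent_mapE.
Qed.

Lemma derive_tangent_mapl w v : nonzero_over w ->
  lsubmx ('D_v tangent_map w) = 'D_(lsubmx v) phi (lsubmx w).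
Proof.
move=> Uw; have dT := Coo_differentiable tangent_map_smooth Uw.
have dl := rV_linear_differentiable (@lsubmx R 1 n n) (tangent_map w).
have := derive_comp v dT dl; rewrite derive_linear => <-.
rewrite -derive_pullback //; apply: near_eq_derive.
by apply: (open_near nonzero_over_open Uw) => y Uy /=; rewrite row_mxKl.
Qed.

(** A fibre direction leaves the base point fixed, and there the map is linear
    in y. Formally: the second derivative that arises vanishes after exchanging
    the order, since the pulled-back map is constant along the fibres. *)
Lemma derive_tangent_map_fibre w v : nonzero_over w ->
  'D_(fibre_row v) tangent_map w = fibre_row ('D_v phi (lsubmx w)).
Proof.
move=> Uw; rewrite -[LHS]hsubmxK derive_tangent_mapl // lsubmx_fibre_row
  derive0.
congr row_mx; have oN := nonzero_over_open.
have dT := Coo_differentiable tangent_map_smooth Uw.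
have dr := rV_linear_differentiable (@rsubmx R 1 n n) (tangent_map w).
have := derive_comp (fibre_row v) dT dr; rewrite derive_linear => <-.
have tautological_smooth : Coo nonzero_over tautological by move=> k;
  exact: Ck_linear.
have -> : 'D_(fibre_row v) (rsubmx \o tangent_map) w =
          'D_(fibre_row v) (fun w => 'D_(tautological w) pullback w) w.
  apply: near_eq_derive; apply: (open_near oN Uw) => y Uy /=.
  rewrite row_mxKr; apply/esym/(etrans (derive_pullback (tautological y) Uy)).
  by rewrite lsubmx_base_row.
rewrite (derive_along (fibre_row v) oN pullback_smooth tautological_smooth Uw).
rewrite (Schwarz_row _ _ oN pullback_smooth Uw).
have -> : 'D_(tautological w) ('D_(fibre_row v) pullback) w =
  'D_(tautological w) (cst 0) w.
  apply: near_eq_derive; apply: (open_near oN Uw) => y Uy /=.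
  by rewrite derive_pullback // lsubmx_fibre_row derive0.
rewrite derive_cst addr0 derive_linear; apply: etrans (derive_pullback _ Uw) _.
by rewrite /= rsubmx_fibre_row lsubmx_base_row.
Qed.

End TangentTransition.

Section SlitAtlas.
Context {R : realType} {n : nat} (M : manifold R n).

Lemma manifold_smooth_atlas : smooth_atlas (charts M).
Proof.
split.
- exact: dom_chart_at.
- exact: coord_inj.
- move=> a b; apply: coord_open; last by move=> p [].
  by apply: openI; exact: dom_open.
- exact: transition_smooth.
Qed.

Let hM := manifold_smooth_atlas.
Local Notation T := (slit_atlas M).
Implicit Types (a b : chart (charts M)) (u : slit M).

Let overlap a b : set 'rV[R]_n := coord a @` (dom a `&` dom b).

(** The components in the preferred chart are recovered from those in the chart
    a through the transition map. *)
Lemma components_inj a p : dom a p -> injective (components (A :=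
  charts M) a p).
Proof.
move=> ap v w vw; have cp := dom_chart_at_self hM p.
rewrite -(components_chart_at hM p v) -(components_chart_at hM p w).
by rewrite !(components_transition hM _ ap cp) vw.
Qed.

Lemma components_surj a p y : dom a p ->
  exists v, components (A := charts M) a p v = y.
Proof.
move=> ap; have cp := dom_chart_at_self hM p; rewrite /components.
move: (chart_at (charts M) p) cp => c cp.
exists ('D_y (transition a c) (coord a p)).
have dac := transition_differentiable hM ap cp.
have dca : differentiable (transition c a) (transition a c (coord a p)).
  by rewrite (transitionE hM c ap); exact: transition_differentiable.
have := derive_comp y dac dca; rewrite (transitionE hM c ap) => <-.
rewrite (near_eq_derive (g := id)) ?derive_id //.
apply: (near_overlap hM ap cp) => q aq cq /=.
by rewrite !(transitionE hM).
Qed.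

Lemma slit_coord_inj a u u' : dom (a : chart T) u -> dom (a : chart T) u' ->
  coord (a : chart T) u = coord (a : chart T) u' -> u = u'.
Proof.
case: u u' => [[p v] v0] [[q w] w0] /= ap aq /eq_row_mx[pq].
have {}pq : p = q := coord_inj ap aq pq.
by case: q / pq w w0 aq => w w0 _ /(components_inj ap) vw; apply: val_inj;
  rewrite /= vw.
Qed.

(** The slit bundle over an overlap fills all pairs (x,y) with y nonzero,
    because the change of components is bijective; its chart images are
    therefore open. *)
Lemma slit_overlap a b :
  coord (a : chart T) @` (dom (a : chart T) `&` dom (b : chart T)) =
  nonzero_over (overlap a b).
Proof.
apply/seteqP; split=> [_ [[[p v] v0] /= [ap bp] <-]|w [[p [ap bp] pw] w0]].
  rewrite /nonzero_over /= row_mxKl row_mxKr; split; first by exists p.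
  apply: contra_neq v0 => v0; apply: (components_inj ap).
  by rewrite v0 /components derive0.
have [v vE] := components_surj (rsubmx w) ap.
have v0 : v != 0.
  by apply: contra_neq w0 => v0; rewrite -vE v0 /components derive0.
by exists (exist _ (p, v) v0) => //=; rewrite vE pw hsubmxK.
Qed.

Lemma slit_transition a b w : nonzero_over (overlap a b) w ->
  transition (a : chart T) (b : chart T) w = tangent_map (transition a b) w.
Proof.
rewrite -slit_overlap => -[u [au bu] <-].
have inj q : dom (a : chart T) q ->
  coord (a : chart T) q = coord (a : chart T) u ->
    q = u by move=> aq; exact: slit_coord_inj.
apply: etrans (local_expr_coord (coord (b : chart T)) inj au) _.
case: u au bu {inj} => [[p v] v0] /= ap bp.
rewrite /tangent_map row_mxKl row_mxKr (transitionE hM b ap).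
by rewrite -(components_transition hM v ap bp).
Qed.

Lemma slit_smooth_atlas : smooth_atlas T.
Proof.
split.
- by move=> u; exact: (dom_chart_at_self hM).
- exact: slit_coord_inj.
- move=> a b; rewrite slit_overlap; apply: nonzero_over_open.
  exact: (overlap_open hM).
- move=> a b k; rewrite slit_overlap.
  have oab := overlap_open hM a b; have sab := overlap_smooth hM a b.
  apply: eq_Ck (nonzero_over_open oab) _ (tangent_map_smooth oab sab k) => w Uw.
  exact/esym/slit_transition.
Qed.

Let hT := slit_smooth_atlas.

Lemma slit_components a u w : dom (a : chart T) u ->
  components (a : chart T) u w =
  'D_w (tangent_map (transition (chart_at (charts M) (sval u).1) a))
    (coord (chart_at T u) u).
Proof.
move=> au; have cu := dom_chart_at_self hT u.
rewrite /components; apply: near_eq_derive.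
apply: (near_overlap hT cu au) => q cq aq; apply: slit_transition.
by rewrite -slit_overlap; exists q.
Qed.

Lemma lsubmx_slit_components a u w : dom (a : chart T) u ->
  lsubmx (components (a : chart T) u w) =
  components (A := charts M) a (sval u).1 (lsubmx w).
Proof.
move=> au; have cu := dom_chart_at_self hT u.
rewrite slit_components // (derive_tangent_mapl (U :=
  overlap (chart_at (charts M) (sval u).1) a)).
- by rewrite row_mxKl.
- exact: (overlap_open hM).
- exact: (overlap_smooth hM).
- by rewrite -slit_overlap; exists u.
Qed.

Lemma slit_components_fibre a u v : dom (a : chart T) u ->
  components (a : chart T) u (fibre_row v) =
  fibre_row (components (A := charts M) a (sval u).1 v).
Proof.
move=> au; have cu := dom_chart_at_self hT u.
rewrite slit_components // (derive_tangent_map_fibre (U :=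
  overlap (chart_at (charts M) (sval u).1) a)).
- by rewrite row_mxKl.
- exact: (overlap_open hM).
- exact: (overlap_smooth hM).
- by rewrite -slit_overlap; exists u.
Qed.


Local Notation J := (@Jform R n M).
Local Notation C := (liouville (M := M)).
Implicit Types X Y V S : vfield M.

(** J keeps the base components and moves them to the fibre; by the two
    derivatives of the tangent transition map this description holds in every
    chart. *)
Lemma local_Jform X a u : dom (a : chart T) u ->
  local_field (a : chart T) (J X) (coord (a : chart T) u) =
  fibre_row (lsubmx (local_field (a : chart T) X (coord (a : chart T) u))).
Proof.
move=> au; rewrite !(local_fieldE hT _ au) lsubmx_slit_components //.
exact: slit_components_fibre.
Qed.

Lemma local_liouville a u : dom (a : chart T) u ->
  local_field (a : chart T) C (coord (a : chart T) u) =
  fibre_row (rsubmx (coord (a : chart T) u)).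
Proof.
move=> au; rewrite (local_fieldE hT _ au) [X in rsubmx X]/= row_mxKr.
exact: slit_components_fibre.
Qed.

Lemma smooth_Jform X : smooth_vfield X -> smooth_vfield (J X).
Proof.
move=> sX a k; have oa := chart_image_open hT a.
have CX := Ck_linear_comp (fibre_row \o lsubmx) oa (sX a k).
by apply: (eq_Ck oa _ CX) => _ [u au <-]; rewrite local_Jform.
Qed.

Lemma smooth_liouville : smooth_vfield C.
Proof.
move=> a k; have oa := chart_image_open hT a.
apply: (eq_Ck oa _ (Ck_linear k _ (fibre_row \o rsubmx))).
by move=> _ [u au <-]; rewrite local_liouville.
Qed.

Lemma derive_local_Jform X a u v : smooth_vfield X -> dom (a : chart T) u ->
  'D_v (local_field (a : chart T) (J X)) (coord (a : chart T) u) =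
  fibre_row (lsubmx ('D_v (local_field (a : chart T) X) (coord (a : chart T)
    u))).
Proof.
move=> sX au; have dX := smooth_field_differentiable sX au.
have dL := rV_linear_differentiable (fibre_row \o lsubmx)
  (local_field (a : chart T) X (coord (a : chart T) u)).
apply: etrans _ (etrans (derive_comp v dX dL) (derive_linear _ _ _)).
apply: near_eq_derive; apply: (near_chart hT au) => q aq.
exact: local_Jform.
Qed.

Lemma derive_local_liouville a u v : dom (a : chart T) u ->
  'D_v (local_field (a : chart T) C) (coord (a : chart T) u) =
    fibre_row (rsubmx v).
Proof.
move=> au.
apply: etrans _ (derive_linear (fibre_row \o rsubmx) (coord (a : chart T) u) v).
apply: near_eq_derive; apply: (near_chart hT au) => q aq.
exact: local_liouville.
Qed.

Lemma JformE X u : J X u = fibre_row (lsubmx (X u)). Proof. by []. Qed.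

Lemma lieE X Y u : lie T X Y u =
  'D_(X u) (local_field (chart_at T u) Y) (coord (chart_at T u) u) -
  'D_(Y u) (local_field (chart_at T u) X) (coord (chart_at T u) u).
Proof. by []. Qed.

Lemma Jform_Jform X : J (J X) = 0.
Proof. by apply/funext => u; rewrite !JformE lsubmx_fibre_row linear0. Qed.

Lemma Jform_liouville : J C = 0.
Proof. by apply/funext => u; rewrite JformE lsubmx_fibre_row linear0. Qed.

Lemma JformB X Y : J (X - Y) = J X - J Y.
Proof. by apply/funext => u; rewrite !fctE !JformE lsubmxB fibre_rowB. Qed.

(** In a chart J is a constant matrix of square zero. *)
Lemma Jform_nijenhuis X Y : smooth_vfield X -> smooth_vfield Y ->
  lie T (J X) (J Y) = J (lie T (J X) Y) + J (lie T X (J Y)).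
Proof.
move=> sX sY; apply/funext => u; have au := dom_chart_at_self hT u.
pose sub v w : 'rV[R]_(n + n) := v - w.
have JXJY : lie T (J X) (J Y) u = _ := congr2 sub
  (derive_local_Jform (J X u) sY au) (derive_local_Jform (J Y u) sX au).
have JXY : lie T (J X) Y u = _ :=
  congr2 sub erefl (derive_local_Jform (Y u) sX au).
have XJY : lie T X (J Y) u = _ :=
  congr2 sub (derive_local_Jform (X u) sY au) erefl.
apply: etrans JXJY (esym _).
apply: etrans (congr2 (fun v w => fibre_row (lsubmx v) + fibre_row (lsubmx w))
  JXY XJY) _.
exact: (congr2 +%R (fibre_row_subr _ _) (fibre_row_subl _ _)).
Qed.

(** J lowers the degree of homogeneity by one: C is linear in a chart and its
    derivative is the projection on the fibre. *)
Lemma lie_liouville_Jform X : smooth_vfield X ->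
  lie T C (J X) = J (lie T C X) - J X.
Proof.
move=> sX; apply/funext => u; have au := dom_chart_at_self hT u.
pose sub v w : 'rV[R]_(n + n) := v - w.
have CJX : lie T C (J X) u = _ := congr2 sub
  (derive_local_Jform (C u) sX au) (derive_local_liouville (J X u) au).
have CX : lie T C X u = _ := congr2 sub erefl (derive_local_liouville (X u) au).
apply: etrans CJX (esym _).
apply: etrans (congr2 (fun v w => fibre_row (lsubmx v) - w) CX (JformE X u)) _.
have JXE : fibre_row (lsubmx (X u)) =
  fibre_row (rsubmx (J X u)) by rewrite JformE rsubmx_fibre_row.
exact: (congr2 sub (fibre_row_subr _ _) JXE).
Qed.

(** In a chart J S = C says that the base components of S are y; the derivative
    of y along a vertical V is V itself. So every vertical field is J of a
    smooth field. *)
Lemma semispray_vertical S V : smooth_vfield S -> smooth_vfield V ->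
  J S = C -> J V = 0 -> J (lie T V S) = V.
Proof.
move=> sS sV JS JV; apply/funext => u; have au := dom_chart_at_self hT u.
have Vfibre v : fibre_row (lsubmx ('D_v (local_field (chart_at T u) V)
    (coord (chart_at T u) u))) = 0.
  rewrite -derive_local_Jform // JV.
  rewrite (near_eq_derive (g := cst 0)) ?derive_cst //.
  apply: (near_chart hT au) => q aq.
  by rewrite (local_fieldE hT _ aq) /components derive0.
have Sfibre v : fibre_row (lsubmx ('D_v (local_field (chart_at T u) S)
    (coord (chart_at T u) u))) = fibre_row (rsubmx v).
  by rewrite -derive_local_Jform // JS; exact: derive_local_liouville.
have /(congr1 rsubmx) : fibre_row (lsubmx (V u)) = 0 by rewrite -JformE JV.
rewrite rsubmx_fibre_row linear0 => lV.
rewrite JformE lieE lsubmxB fibre_rowB.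
pose sub v w : 'rV[R]_(n + n) := v - w.
apply: etrans (congr2 sub (Sfibre (V u)) (Vfibre (S u))) _.
by rewrite /sub subr0 /fibre_row -lV hsubmxK.
Qed.

End SlitAtlas.

(** * The algebra of a Finsler space *)
Section Halving.
Context {K : numFieldType}.

Lemma addr_half (V : lmodType K) (x : V) : 2^-1 *: x + 2^-1 *: x = x.
Proof.
by rewrite -scalerDl -[X in X + _]div1r -[X in _ + X]div1r -splitr scale1r.
Qed.

Lemma addrr_eq0 (V : lmodType K) (x : V) : x + x = 0 -> x = 0.
Proof. by move=> xx; rewrite -[x]addr_half -scalerDr xx scaler0. Qed.

Lemma addrr_inj (V : lmodType K) (x y : V) : x + x = y + y -> x = y.
Proof.
by move=> xy; apply/subr0_eq/addrr_eq0; rewrite addrACA -opprD xy subrr.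
Qed.

Lemma raddf_half (V W : lmodType K) (f : {additive V -> W}) x :
  f (2^-1 *: x) = 2^-1 *: f x.
Proof. by apply: addrr_inj; rewrite -raddfD !addr_half. Qed.

End Halving.

(** Fields form the Lie algebra V, which acts on the space W of functions; all
    operations are additive, so they commute with halving. Elements are
    separated by the scalars [valV i] and [valW i] (components of fields,
    values of functions), so that identities between sums can be settled by
    ring computations in K. *)
Section FinslerAlgebra.
Context {K : numFieldType} {V W : lmodType K} {IV IW : Type}.
Variables (valV : IV -> {additive V -> K}) (valW : IW -> {additive W -> K}).
Hypothesis valV_inj : forall X Y, (forall i, valV i X = valV i Y) -> X = Y.
Hypothesis valW_inj : forall f g, (forall i, valW i f = valW i g) -> f = g.
Variables (lie : V -> {additive V -> V}) (act : V -> {additive W -> W}).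
Hypothesis lieC : forall X Y, lie X Y = - lie Y X.
Hypothesis jacobi : forall X Y Z,
  lie X (lie Y Z) = lie (lie X Y) Z + lie Y (lie X Z).
Hypothesis actDl : forall X Y f, act (X + Y) f = act X f + act Y f.
Hypothesis act_lie : forall X Y f,
  act (lie X Y) f = act X (act Y f) - act Y (act X f).
Variables (J : {additive V -> V}) (C : V).
Hypothesis JJ : forall X, J (J X) = 0.
Hypothesis JC : J C = 0.
Hypothesis nijenhuis : forall X Y,
  lie (J X) (J Y) = J (lie (J X) Y) + J (lie X (J Y)).
Hypothesis lieCJ : forall X, lie C (J X) = J (lie C X) - J X.
Hypothesis vertical : forall S X, J S = C -> J X = 0 -> J (lie X S) = X.

(* The maps are listed one by one: a rule for all additive maps would match the
   opposite as well, and loop. *)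
Let additivity := (fun t => (raddfD (valV t), raddfN (valV t), raddf0 (valV t)),
  fun t => (raddfD (valW t), raddfN (valW t), raddf0 (valW t)),
  fun X => (raddfD (lie X), raddfN (lie X), raddf0 (lie X)),
  fun X => (raddfD (act X), raddfN (act X), raddf0 (act X)),
  (raddfD J, raddfN J, raddf0 J)).

Ltac vring := apply: valV_inj => ?; rewrite ?additivity; ring.
Ltac wring := apply: valW_inj => ?; rewrite ?additivity; ring.

Lemma lieDl X Y Z : lie (X + Y) Z = lie X Z + lie Y Z.
Proof. by rewrite lieC raddfD opprD -!lieC. Qed.

Lemma lieNl X Y : lie (- X) Y = - lie X Y.
Proof. by rewrite lieC raddfN [X in _ = - X]lieC. Qed.

Lemma lie0l X : lie 0 X = 0. Proof. by rewrite lieC raddf0 oppr0. Qed.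

Lemma act0l f : act 0 f = 0.
Proof. by apply: (addIr (act 0 f)); rewrite -actDl !add0r. Qed.

Lemma actNl X f : act (- X) f = - act X f.
Proof. by apply/eqP; rewrite -addr_eq0 -actDl addNr act0l. Qed.

Section Energy.
Variable E : W.
Hypothesis energy2 : act C E = E + E.

(** The 1-form d_J E; [omega] is its exterior derivative. *)
Definition theta X : W := act (J X) E.

Definition omega X Y : W := act X (theta Y) - act Y (theta X) - theta (lie X Y).

Hypothesis nondegenerate : forall X, (forall Y, omega X Y = 0) -> X = 0.

Lemma thetaD X Y : theta (X + Y) = theta X + theta Y.
Proof. by rewrite /theta raddfD actDl. Qed.

Lemma thetaN X : theta (- X) = - theta X.
Proof. by rewrite /theta raddfN actNl. Qed.

Lemma theta_J X : theta (J X) = 0.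
Proof. by rewrite /theta JJ act0l. Qed.

Lemma omegaC X Y : omega X Y = - omega Y X.
Proof. by rewrite /omega [lie X Y]lieC thetaN; wring. Qed.

Lemma omegaDl X Y Z : omega (X + Y) Z = omega X Z + omega Y Z.
Proof. by rewrite /omega lieDl !thetaD actDl; wring. Qed.

Lemma omegaNl X Y : omega (- X) Y = - omega X Y.
Proof. by rewrite /omega lieNl !thetaN actNl; wring. Qed.

Lemma omega0l X : omega 0 X = 0.
Proof. by apply: (addIr (omega 0 X)); rewrite -omegaDl !add0r. Qed.

Lemma omegaDr X Y Z : omega X (Y + Z) = omega X Y + omega X Z.
Proof. by rewrite omegaC omegaDl opprD -!omegaC. Qed.

Lemma omegaNr X Y : omega X (- Y) = - omega X Y.
Proof. by rewrite omegaC omegaNl [X in _ = - X]omegaC. Qed.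

Lemma omega_inj X Y : (forall Z, omega X Z = omega Y Z) -> X = Y.
Proof.
move=> XY; apply/subr0_eq/nondegenerate => Z.
by rewrite omegaDl omegaNl XY subrr.
Qed.

(** The two sides differ by the Nijenhuis tensor of J applied to E. *)
Lemma omega_J X Y : omega (J X) Y = - omega X (J Y).
Proof.
rewrite /omega !theta_J.
have -> : theta (lie X (J Y)) = act (lie (J X) (J Y)) E - theta (lie (J X) Y).
  by rewrite nijenhuis actDl addrC addKr.
by rewrite act_lie; rewrite /theta; wring.
Qed.

Lemma omega_Jsym X Y : omega (J X) Y = omega (J Y) X.
Proof. by rewrite omega_J -omegaC. Qed.

(** Cartan's formula L_X Omega = d (i_X Omega), which holds as Omega is exact;
    it is used for X = C and X = S, where i_X Omega is known. *)
Lemma cartan X Y Z :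
  act X (omega Y Z) - omega (lie X Y) Z - omega Y (lie X Z) =
  act Y (omega X Z) - act Z (omega X Y) - omega X (lie Y Z).
Proof. by rewrite /omega (jacobi X Y Z) thetaD !act_lie; wring. Qed.

Variable S : V.
Hypothesis spray : forall X, omega S X = - act X E.

(** Homogeneity of E enters here. *)
Lemma omega_C X : omega C X = theta X.
Proof.
rewrite /omega.
have -> : theta C = 0 by rewrite /theta JC act0l.
have -> : theta (lie C X) = act (lie C (J X)) E + theta X.
  by rewrite lieCJ actDl actNl addrNK.
by rewrite act_lie energy2 /theta; wring.
Qed.

(** Both sides have the same contraction with Omega, namely d_J E. *)
Lemma J_spray : J S = C.
Proof.
apply: omega_inj => X.
by rewrite omega_J spray opprK omega_C.
Qed.

(** L_C Omega = d (d_J E) = Omega. *)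
Lemma act_C_omega X Y :
  act C (omega X Y) = omega X Y + omega (lie C X) Y + omega X (lie C Y).
Proof.
have := cartan C X Y; rewrite !omega_C -/(omega X Y) => cartanC.
by rewrite -[X in _ = X + _ + _]cartanC; wring.
Qed.

(** L_S Omega = d (- dE) = 0. *)
Lemma act_S_omega X Y :
  act S (omega X Y) = omega (lie S X) Y + omega X (lie S Y).
Proof.
apply/subr0_eq; rewrite opprD addrA cartan !spray act_lie; wring.
Qed.

Lemma lie_C_spray : lie C S = S.
Proof.
apply: omega_inj => X; have := act_C_omega S X; rewrite !spray => CS.
have -> : omega (lie C S) X = act C (- act X E) + act X E + act (lie C X) E.
  by rewrite CS; wring.
by rewrite act_lie energy2; wring.
Qed.

(** The Barthel connection [J,S], an almost product structure. *)
Definition almost_product X : V := - (lie S (J X) - J (lie S X)).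

Local Notation G := almost_product.

Lemma almost_productE X : G X = lie (J X) S - J (lie X S).
Proof. by rewrite /almost_product [lie (J X) S]lieC [lie X S]lieC; vring. Qed.

Lemma almost_productD X Y : G (X + Y) = G X + G Y.
Proof. by rewrite /almost_product; vring. Qed.

Lemma almost_productN X : G (- X) = - G X.
Proof. by rewrite /almost_product; vring. Qed.

Lemma almost_product_vertical X : J X = 0 -> G X = - X.
Proof.
by move=> JX; rewrite almost_productE JX lie0l (vertical J_spray JX) sub0r.
Qed.

Lemma J_almost_product X : J (G X) = J X.
Proof.
by rewrite almost_productE raddfB JJ subr0 (vertical J_spray (JJ X)).
Qed.

(** G X - X is vertical, and G is -1 on vertical fields. *)
Lemma almost_productK X : G (G X) = X.
Proof.
have : G (G X - X) = - (G X - X).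
  by apply: almost_product_vertical; rewrite raddfB J_almost_product subrr.
by rewrite almost_productD almost_productN opprB => /addIr.
Qed.

(** Apply L_S to i_J Omega = 0: since L_S Omega = 0, only i_G Omega = 0
    remains. *)
Lemma omega_almost_product X Y : omega (G X) Y = - omega X (G Y).
Proof.
have JZT Z T : omega (J Z) T + omega Z (J T) = 0 by rewrite omega_J addNr.
have SJ : (omega (lie S (J X)) Y + omega (J X) (lie S Y)) +
          (omega (lie S X) (J Y) + omega X (lie S (J Y))) = 0.
  by rewrite -!act_S_omega -raddfD JZT raddf0.
apply/eqP; rewrite -addr_eq0 -oppr_eq0 -[X in _ == X]SJ; apply/eqP.
rewrite /almost_product !(omegaNl, omegaNr, omegaDl, omegaDr) [omega (J (lie S
  X)) Y]omega_J.
by rewrite [omega (J X) (lie S Y)]omega_J; wring.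
Qed.

Definition horproj X : V := 2^-1 *: (X + G X).

Definition verproj X : V := 2^-1 *: (X - G X).

Local Notation h := horproj.

Local Notation v := verproj.

Lemma horproj_verprojD X : h X + v X = X.
Proof. by rewrite -scalerDr addrACA subrr addr0 scalerDr addr_half. Qed.

Lemma horprojD X Y : h (X + Y) = h X + h Y.
Proof. by rewrite /horproj almost_productD addrACA scalerDr. Qed.

Lemma verprojD X Y : v (X + Y) = v X + v Y.
Proof. by rewrite /verproj almost_productD opprD addrACA scalerDr. Qed.


Lemma almost_product_half X : G (2^-1 *: X) = 2^-1 *: G X.
Proof. by apply: addrr_inj; rewrite -almost_productD !addr_half. Qed.

Lemma almost_product_horproj X : G (h X) = h X.
Proof.
by rewrite almost_product_half almost_productD almost_productK addrC.
Qed.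

Lemma J_horproj X : J (h X) = J X.
Proof. by rewrite raddf_half raddfD J_almost_product scalerDr addr_half. Qed.

Lemma J_verproj X : J (v X) = 0.
Proof.
by apply: (addrI (J (h X))); rewrite -raddfD horproj_verprojD J_horproj addr0.
Qed.

Lemma horproj_vertical X : J X = 0 -> h X = 0.
Proof.
by move=> JX; rewrite /horproj almost_product_vertical // subrr scaler0.
Qed.

Lemma verproj_vertical X : J X = 0 -> v X = X.
Proof.
by move=> JX; rewrite -[RHS]horproj_verprojD horproj_vertical // add0r.
Qed.

Lemma horproj_idem X : h (h X) = h X.
Proof. by rewrite {1}/horproj almost_product_horproj scalerDr addr_half. Qed.

Lemma verproj_horproj X : v (h X) = 0.
Proof. by rewrite /verproj almost_product_horproj subrr scaler0. Qed.

Lemma horproj0 : h 0 = 0. Proof. by rewrite horproj_vertical ?raddf0. Qed.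

Lemma verproj0 : v 0 = 0. Proof. by rewrite verproj_vertical ?raddf0. Qed.

Lemma horprojN X : h (- X) = - h X.
Proof. by apply/eqP; rewrite -addr_eq0 -horprojD addNr horproj0. Qed.

Lemma verprojN X : v (- X) = - v X.
Proof. by apply/eqP; rewrite -addr_eq0 -verprojD addNr verproj0. Qed.

Lemma verticalP X : J X = 0 -> X = J (lie X S).
Proof. by move=> JX; rewrite (vertical J_spray JX). Qed.

Lemma omega_vertical X Y : J X = 0 -> J Y = 0 -> omega X Y = 0.
Proof.
by move=> /verticalP -> JY; rewrite omega_J JY omegaC omega0l !oppr0.
Qed.

(** G is the identity on horizontal fields and skew for Omega, so horizontal
    fields are isotropic. *)
Lemma omega_horproj X Y : omega (h X) (h Y) = 0.
Proof.
by apply: addrr_eq0; rewrite -{1}almost_product_horproj omega_almost_product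
  almost_product_horproj addNr.
Qed.

Lemma J_lie_vertical X Y : J X = 0 -> J Y = 0 -> J (lie X Y) = 0.
Proof.
by move=> /verticalP -> /verticalP ->; rewrite nijenhuis -raddfD JJ.
Qed.

(** The weak torsion [J,h] of the Barthel connection vanishes, because
    [J,[J,S]] is half of [[J,J],S]. Concretely, the bracket with S is applied
    to the vanishing Nijenhuis tensor of J. *)
Lemma J_lie_horproj X Y :
  J (lie (h X) (h Y)) = v (lie (h X) (J Y)) + v (lie (J X) (h Y)).
Proof.
rewrite -verprojD -(J_horproj X) -(J_horproj Y);
  move: (h X) (h Y) (almost_product_horproj X) (almost_product_horproj Y) =>
    {}X {}Y GX GY.
have SJ Z : G Z = Z -> lie S (J Z) = J (lie S Z) - Z.
  by move=> GZ; rewrite -[X in _ - X]GZ /almost_product; vring.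
set T := lie X (J Y) + lie (J X) Y.
have JT : J T = lie (J X) (J Y) by rewrite nijenhuis /T; vring.
have GT : T - G T = J (lie X Y) + J (lie X Y).
  rewrite /almost_product JT (jacobi S (J X) (J Y)) (SJ X GX) (SJ Y GY).
  rewrite /T (raddfD (lie S)) (jacobi S (J X) Y) (jacobi S X (J Y)) (SJ X GX)
    (SJ Y GY).
  by rewrite !lieDl !lieNl !(raddfD (lie (J X))) (nijenhuis _ Y) (nijenhuis X);
    vring.
by rewrite /verproj GT scalerDr addr_half.
Qed.

(** D is the connection, F the almost complex structure and Cp the tensor C';
    the metric is Omega (X, F Y). *)
Section ChernConnection.
Variables (D : V -> {additive V -> V}) (F : {additive V -> V}) (Cp : V -> V ->
  V).
Hypothesis DDl : forall X Y Z, D (X + Y) Z = D X Z + D Y Z.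
Hypothesis D_J : forall X Y, D X (J Y) = J (D X Y).
Hypothesis D_C : forall X, D X C = v X.
Hypothesis D_JJ : forall X Y, D (J X) (J Y) = J (lie (J X) Y).
Hypothesis D_torsion : forall X Y,
  J (D (h X) (h Y) - D (h Y) (h X) - lie (h X) (h Y)) = 0.
Hypothesis F_J : forall X, F (J X) = h X.
Hypothesis F_h : forall X, F (h X) = - J X.
Hypothesis D_metric : forall X Y Z, act (h X) (omega Y (F Z)) =
  omega (D (h X) Y) (F Z) + omega Y (F (D (h X) Z)).
Hypothesis CpC : forall X Y, Cp X Y = Cp Y X.
Hypothesis CpE : forall X Y Z, omega (Cp X Y) Z + omega (Cp X Y) Z =
  act (h X) (omega (J Y) (F (J Z))) - omega (lie (h X) (J Y)) (F (J Z))
  - omega (J Y) (F (lie (h X) (J Z))).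

Definition curv X Y Z : V := D X (D Y Z) - D Y (D X Z) - D (lie X Y) Z.

Lemma DNl X Y : D (- X) Y = - D X Y.
Proof.
have D0 : D 0 Y = 0 by apply: (addIr (D 0 Y)); rewrite -DDl !add0r.
by apply/eqP; rewrite -addr_eq0 -DDl addNr D0.
Qed.

Lemma D_horproj X Y : D (h X) (J Y) - D (h Y) (J X) = J (lie (h X) (h Y)).
Proof.
apply/subr0_eq; rewrite -[RHS](D_torsion X Y) !raddfB -!D_J !J_horproj.
by [].
Qed.

(** The torsion of D takes vertical values on all pairs of fields: on
    horizontal pairs by assumption, and when one argument is vertical by
    normality. *)
Lemma D_torsionfree X Y : D X (J Y) - D Y (J X) = J (lie X Y).
Proof.
have Dhv Z T : D Z (J T) = D (h Z) (J T) + J (lie (v Z) T).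
  by rewrite -{1}(horproj_verprojD Z) DDl; congr (_ + _);
    rewrite (verticalP (J_verproj Z)) D_JJ.
rewrite (Dhv X) (Dhv Y).
have -> : J (lie X Y) = J (lie (h X) Y) + J (lie (v X) Y).
  by rewrite -(raddfD J) -lieDl horproj_verprojD.
have -> : J (lie (h X) Y) = J (lie (h X) (h Y)) + J (lie (h X) (v Y)).
  by rewrite -(raddfD J) -(raddfD (lie (h X))) horproj_verprojD.
have -> : J (lie (v Y) X) = - J (lie (h X) (v Y)).
  have -> : lie (v Y) X = lie (v Y) (h X) + lie (v Y) (v X).
    by rewrite -(raddfD (lie (v Y))) horproj_verprojD.
  by rewrite (raddfD J) (J_lie_vertical (J_verproj Y) (J_verproj X)) addr0 lieC
    raddfN.
by rewrite -D_horproj; vring.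
Qed.

Lemma curvC X Y Z : curv X Y Z = - curv Y X Z.
Proof. by rewrite /curv [lie X Y]lieC DNl; vring. Qed.

Lemma curv_J X Y Z : curv X Y (J Z) = J (curv X Y Z).
Proof. by rewrite /curv !raddfB !D_J. Qed.

(** Regroup the six second derivatives with [D_torsionfree]; what is left is J
    of the cyclic sum in the Jacobi identity. *)
Lemma bianchi X Y Z : curv X Y (J Z) + curv Y Z (J X) + curv Z X (J Y) = 0.
Proof.
have tf A B : D A (J B) = D B (J A) + J (lie A B).
  by rewrite -D_torsionfree addrC subrK.
rewrite /curv (tf Y Z) (tf Z X) (tf X Y).
rewrite !(raddfD (D _)) (tf X (lie Y Z)) (tf Y (lie Z X)) (tf Z (lie X Y)).
have cyclic : J (lie X (lie Y Z)) + J (lie Y (lie Z X)) + J (lie Z (lie X Y)) =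
  0.
  by rewrite (jacobi X Y Z) [lie Z X]lieC [lie Z (lie X Y)]lieC; vring.
by apply: etrans cyclic; vring.
Qed.

(** In [bianchi] for hX, JY, hZ the third term contains J (J Y) = 0. *)
Lemma hv_curvC X Y Z : curv (h X) (J Y) (J Z) = curv (h Z) (J Y) (J X).
Proof.
have := bianchi (h X) (J Y) (h Z); rewrite !J_horproj.
have -> : curv (h Z) (h X) (J (J Y)) = 0 by rewrite !curv_J JJ.
rewrite addr0 [curv (J Y) _ _]curvC.
by move/subr0_eq.
Qed.

Lemma h_curv_spray X Y : curv (h X) (h Y) (J S) = - v (lie (h X) (h Y)).
Proof.
by rewrite /curv J_spray !D_C !verproj_horproj !(raddf0 (D _)) subrr sub0r.
Qed.

(** The two sides differ by h [vX,vY], and brackets of vertical fields are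
    vertical. *)
Lemma barthel_curvatureE X Y :
  lie (h X) (h Y) + h (lie X Y) - h (lie (h X) Y) - h (lie X (h Y)) =
  v (lie (h X) (h Y)).
Proof.
have : h (lie (v X) (v Y)) =
  0 by rewrite horproj_vertical // J_lie_vertical ?J_verproj.
have vE Z : v Z = Z - h Z by rewrite -[Z in Z - _]horproj_verprojD addrC addKr.
have -> : lie (v X) (v Y) =
    lie X Y - lie (h X) Y - lie X (h Y) + lie (h X) (h Y).
  by rewrite (vE X) (vE Y) lieDl lieNl; vring.
rewrite !(horprojD, horprojN) => hvv; apply/subr0_eq; rewrite -[RHS]hvv vE;
  vring.
Qed.

(** The Berwald connection is v [hX,JY] on vertical fields. *)
Definition berwald_difference X Y : V := D (h X) (J Y) - v (lie (h X) (J Y)).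

Lemma hv_curv_spray X Y : curv (h X) (J Y) (J S) = berwald_difference X Y.
Proof.
by rewrite /curv J_spray !D_C verproj_horproj (raddf0 (D _)) subr0
  verproj_vertical // JJ.
Qed.

Lemma berwald_differenceC X Y : berwald_difference X Y = berwald_difference Y X.
Proof.
apply/subr0_eq.
have -> : berwald_difference X Y - berwald_difference Y X =
  (D (h X) (J Y) - D (h Y) (J X)) -
    (v (lie (h X) (J Y)) - v (lie (h Y) (J X))) by rewrite /berwald_difference;
      vring.
by rewrite D_horproj J_lie_horproj [lie (J X) (h Y)]lieC verprojN subrr.
Qed.

Lemma omega_vertical_horproj X Y : J X = 0 -> omega X (h Y) = omega X Y.
Proof.
by move=> JX; rewrite -{2}(horproj_verprojD Y) omegaDr (omega_vertical JX
  (J_verproj Y)) addr0.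
Qed.

Lemma omega_horprojr X Y : omega X (h Y) = omega (v X) Y.
Proof.
by rewrite -{1}(horproj_verprojD X) omegaDl omega_horproj add0r
  omega_vertical_horproj ?J_verproj.
Qed.

Lemma omega_J_F X Y : omega (J X) (F Y) = omega (v Y) X.
Proof.
rewrite -{1}(horproj_verprojD Y) raddfD F_h omegaDr omegaNr (omega_vertical (JJ
  X) (JJ Y)).
rewrite oppr0 add0r (verticalP (J_verproj Y)) F_J omega_vertical_horproj //.
exact: omega_Jsym.
Qed.

(** The metric condition on vertical fields, free of F: as F (J Z) = h Z and
    vertical fields are isotropic, the metric of J Y and J Z is Omega (J Y,
    Z). *)
Lemma act_horproj_omega X Y Z : act (h X) (omega (J Y) Z) =
  omega (D (h X) (J Y)) Z + omega (D (h X) (J Z)) Y.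
Proof.
have := D_metric X (J Y) (J Z); rewrite F_J omega_J_F.
rewrite (omega_vertical_horproj _ (JJ Y)) (verproj_vertical (X :=
  D _ (J Z))) ?D_J ?JJ //.
by rewrite omega_vertical_horproj ?JJ.
Qed.

(** The forms Omega (C'(X,Y), Z) and Omega (D_hX JY - v [hX,JY], Z) are both
    symmetric in X and Y; polarization, as for the Christoffel symbols, shows
    that they coincide. *)
Lemma Cp_berwald_difference X Y : Cp X Y = berwald_difference X Y.
Proof.
have christoffel A B T : omega (Cp A B) T + omega (Cp A B) T =
    omega (berwald_difference A B) T + omega (berwald_difference A T) B.
  rewrite CpE F_J omega_horprojr verproj_vertical // act_horproj_omega
    omega_horprojr omega_J_F /berwald_difference.
  by rewrite !omegaDl !omegaNl; wring.
have swap A B T : omega (berwald_difference A B) T =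
  omega (berwald_difference T B) A.
  have := christoffel T A B;
    rewrite CpC christoffel [berwald_difference T A]berwald_differenceC.
  by move/addrI => ->; rewrite berwald_differenceC.
apply: omega_inj => Z; apply: addrr_inj.
by rewrite christoffel; congr (_ + _);
  rewrite berwald_differenceC swap berwald_differenceC.
Qed.

Lemma hv_curv_spray_Cp X Y : curv (h X) (J Y) (J S) = Cp X Y.
Proof. by rewrite hv_curv_spray Cp_berwald_difference. Qed.

Lemma lie_C_almost_product X : lie C (G X) = G (lie C X).
Proof.
rewrite /almost_product (raddfN (lie C)) (raddfD (lie C)) (raddfN (lie C)).
rewrite (jacobi C S (J X)) (lieCJ X) (lieCJ (lie S X)) (jacobi C S X).
by rewrite lie_C_spray; vring.
Qed.

Lemma lie_C_horproj X : lie C (h X) = h (lie C X).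
Proof. by rewrite raddf_half raddfD lie_C_almost_product. Qed.

(** D_U preserves the metric Omega (J Y, Z) of the vertical bundle. *)
Definition compatible U := forall Y Z, act U (omega (J Y) Z) =
  omega (D U (J Y)) Z + omega (D U (J Z)) Y.

Lemma compatible_C : compatible C.
Proof.
move=> Y Z; rewrite act_C_omega lieCJ omegaDl omegaNl.
rewrite -{3 4}J_spray !D_JJ J_spray [omega (J (lie C Z)) Y]omega_Jsym; wring.
Qed.

(** The usual computation of D_A D_B - D_B D_A - D_[A,B] applied to the metric;
    the mixed terms are exchanged by A <-> B. *)
Lemma curv_skew A B Y Z :
  compatible A -> compatible B -> compatible (lie A B) ->
  omega (curv A B (J Y)) Z = - omega (curv A B (J Z)) Y.
Proof.
move=> cA cB cAB.
have second T U : compatible T -> compatible U ->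
    act T (act U (omega (J Y) Z)) =
    omega (D T (D U (J Y))) Z + omega (D T (D U (J Z))) Y +
    (omega (D T (J Z)) (D U Y) + omega (D U (J Z)) (D T Y)).
  move=> cT cU; rewrite cU raddfD !(D_J U) !cT -!(D_J U).
  have -> : omega (D T (J Y)) (D U Z) = omega (D U (J Z)) (D T Y).
    by rewrite !D_J omega_Jsym.
  by wring.
have /esym/eqP := act_lie A B (omega (J Y) Z).
rewrite cAB !second // -subr_eq0 => /eqP AB.
apply/eqP; rewrite -addr_eq0; apply/eqP; rewrite /curv !omegaDl !omegaNl.
by apply: etrans AB; wring.
Qed.

(** The form Omega (P(X,S)Y, Z) is symmetric in X, Y and skew in Y, Z; six
    exchanges return it to itself with the opposite sign. *)
Lemma hv_curv_C X Z : curv (h X) (J S) (J Z) = 0.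
Proof.
apply: nondegenerate => Y.
have cXC A : compatible (lie (h A) C).
  rewrite lieC lie_C_horproj -horprojN; exact: act_horproj_omega.
have skew A B T : omega (curv (h A) (J S) (J B)) T =
    - omega (curv (h A) (J S) (J T)) B.
  rewrite J_spray; apply: curv_skew => //; first exact: act_horproj_omega.
  exact: compatible_C.
have sym A B T : omega (curv (h A) (J S) (J B)) T =
    omega (curv (h B) (J S) (J A)) T by rewrite hv_curvC.
apply: addrr_eq0.
by rewrite {1}skew sym skew sym skew sym opprK addNr.
Qed.

(** The Froelicher-Nijenhuis bracket [h,h] on X and Y. *)
Definition fn_bracket_horproj X Y : V :=
  lie (h X) (h Y) + lie (h X) (h Y) + h (h (lie X Y)) + h (h (lie X Y))
  - h (lie (h X) Y) - h (lie X (h Y)) - h (lie (h X) Y) - h (lie X (h Y)).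

Lemma fn_bracket_horprojE X Y : 2^-1 *: fn_bracket_horproj X Y =
  v (lie (h X) (h Y)).
Proof.
apply: addrr_inj; rewrite addr_half -barthel_curvatureE /fn_bracket_horproj
  !horproj_idem; vring.
Qed.

Theorem chern_curvatures X Y Z :
  curv (h X) (h Y) (J S) = - (2^-1 *: fn_bracket_horproj X Y) /\
  (curv (h X) (J Y) (J S) = Cp X Y /\ curv (h S) (J Y) (J X) = Cp X Y) /\
  curv (h X) (J S) (J Z) = 0.
Proof.
split; first by rewrite h_curv_spray fn_bracket_horprojE.
split; last exact: hv_curv_C.
split; first exact: hv_curv_spray_Cp.
by rewrite hv_curvC hv_curv_spray_Cp.
Qed.

End ChernConnection.
End Energy.
End FinslerAlgebra.

(** * Smooth fields and functions on the slit bundle as modules *)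

(** Bundling smoothness makes the bracket, the derivative and J total additive
    maps, as the algebra above requires; their laws hold for smooth arguments
    only. *)
Section SmoothModules.
Context {R : realType} {n : nat} (M : manifold R n).
Local Notation T := (slit_atlas M).
Let hT := slit_smooth_atlas M.

Definition smooth_field_pred : {pred slit M -> 'rV[R]_(n + n)} :=
  fun X => `[< smooth_field T X >].

Definition smooth_fun_pred : {pred slit M -> R^o} :=
  fun f => `[< smooth_fun T f >].

Fact smooth_field_submod : GRing.submod_closed smooth_field_pred.
Proof.
split=> [|c X Y /asboolP sX /asboolP sY]; apply/asboolP.
  exact: (smooth_field0 hT).
exact: (smooth_fieldP hT).
Qed.

Fact smooth_fun_submod : GRing.submod_closed smooth_fun_pred.
Proof.
split=> [|c f g /asboolP sf /asboolP sg]; apply/asboolP.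
  exact: (smooth_fun0 hT).
exact: (smooth_funP hT).
Qed.

HB.instance Definition _ := GRing.isSubmodClosed.Build R
  (slit M -> 'rV[R]_(n + n)) smooth_field_pred smooth_field_submod.

HB.instance Definition _ := GRing.isSubmodClosed.Build R
  (slit M -> R^o) smooth_fun_pred smooth_fun_submod.

Record smooth_fields := SmoothField {
  field_of :> slit M -> 'rV[R]_(n + n);
  field_of_smooth : field_of \in smooth_field_pred }.

HB.instance Definition _ := [isSub for field_of].
HB.instance Definition _ := [Choice of smooth_fields by <:].
HB.instance Definition _ := [SubChoice_isSubLmodule of smooth_fields by <:].

Record smooth_funs := SmoothFun {
  fun_of :> slit M -> R^o;
  fun_of_smooth : fun_of \in smooth_fun_pred }.

HB.instance Definition _ := [isSub for fun_of].
HB.instance Definition _ := [Choice of smooth_funs by <:].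
HB.instance Definition _ := [SubChoice_isSubLmodule of smooth_funs by <:].

Implicit Types (X Y Z : smooth_fields) (f : smooth_funs).

Lemma smooth_fieldsP X : smooth_field T X.
Proof. by have /asboolP := field_of_smooth X. Qed.

Lemma smooth_funsP f : smooth_fun T f.
Proof. by have /asboolP := fun_of_smooth f. Qed.

Lemma field_ofD X Y : field_of (X + Y) = field_of X + field_of Y.
Proof. exact: (raddfD val). Qed.

Lemma field_ofN X : field_of (- X) = - field_of X.
Proof. exact: (raddfN val). Qed.

Lemma field_ofB X Y : field_of (X - Y) = field_of X - field_of Y.
Proof. exact: (raddfB val). Qed.

Lemma field_ofZ (c : R) X : field_of (c *: X) = c *: field_of X.
Proof. by rewrite -[LHS]/(val _) linearZ. Qed.

Lemma field_of0 : field_of 0 = 0. Proof. exact: (raddf0 val). Qed.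

Lemma fun_ofD f1 f2 : fun_of (f1 + f2) = fun_of f1 + fun_of f2.
Proof. exact: (raddfD val). Qed.

Lemma fun_ofN f : fun_of (- f) = - fun_of f.
Proof. exact: (raddfN val). Qed.

Lemma fun_ofB f1 f2 : fun_of (f1 - f2) = fun_of f1 - fun_of f2.
Proof. exact: (raddfB val). Qed.

Lemma fun_of0 : fun_of 0 = 0. Proof. exact: (raddf0 val). Qed.

Definition to_field (X : vfield M) (sX : smooth_vfield X) : smooth_fields :=
  SmoothField (asboolT sX).

Definition to_fun (f : slit M -> R^o) (sf : smooth_fun T f) : smooth_funs :=
  SmoothFun (asboolT sf).

Definition component (i : slit M * 'I_(n + n)) X : R := field_of X i.1 0 i.2.

Definition value (u : slit M) f : R := fun_of f u.

(** The prefix s marks operations on bundled smooth fields and functions. *)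
Definition slie X Y : smooth_fields :=
  to_field (smooth_lie hT (smooth_fieldsP X) (smooth_fieldsP Y)).

Definition sact X f : smooth_funs :=
  to_fun (smooth_act hT (smooth_fieldsP X) (smooth_funsP f)).

Definition sJ X : smooth_fields := to_field (smooth_Jform (smooth_fieldsP X)).

Definition sC : smooth_fields := to_field (@smooth_liouville R n M).

Lemma field_of_slie X Y : field_of (slie X Y) = lie T (field_of X) (field_of Y).
Proof. by []. Qed.

Fact component_zmod_morphism i : zmod_morphism (component i).
Proof. by move=> X Y; rewrite /component field_ofB !mxE. Qed.

Fact value_zmod_morphism u : zmod_morphism (value u).
Proof. by move=> f g; rewrite /value fun_ofB. Qed.

Fact slie_zmod_morphism X : zmod_morphism (slie X).
Proof.
move=> Y Z; apply: val_inj; apply: etrans (esym (field_ofB _ _)).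
apply: etrans (congr1 (lie T X) (field_ofB Y Z)) _.
by apply: (lieBr hT); exact: smooth_fieldsP.
Qed.

Fact sact_zmod_morphism X : zmod_morphism (sact X).
Proof.
move=> f g; apply: val_inj; apply: etrans (esym (fun_ofB _ _)).
apply: etrans (congr1 (act T X) (fun_ofB f g)) _.
by apply: (actB hT); exact: smooth_funsP.
Qed.

Fact sJ_zmod_morphism : zmod_morphism sJ.
Proof.
move=> X Y; apply: val_inj; apply: etrans (esym (field_ofB _ _)).
exact: etrans (congr1 (@Jform R n M) (field_ofB X Y)) (JformB _ _).
Qed.

HB.instance Definition _ i := GRing.isZmodMorphism.Build smooth_fields R
  (component i) (component_zmod_morphism i).
HB.instance Definition _ u := GRing.isZmodMorphism.Build smooth_funs R
  (value u) (value_zmod_morphism u).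
HB.instance Definition _ X := GRing.isZmodMorphism.Build smooth_fields
  smooth_fields (slie X) (slie_zmod_morphism X).
HB.instance Definition _ X := GRing.isZmodMorphism.Build smooth_funs
  smooth_funs (sact X) (sact_zmod_morphism X).
HB.instance Definition _ := GRing.isZmodMorphism.Build smooth_fields
  smooth_fields sJ sJ_zmod_morphism.

Lemma component_inj X Y : (forall i, component i X = component i Y) -> X = Y.
Proof.
by move=> XY; apply/val_inj/funext => u; apply/rowP => i; exact: (XY (u, i)).
Qed.

Lemma value_inj f1 f2 : (forall u, value u f1 = value u f2) -> f1 = f2.
Proof. by move=> ff; apply/val_inj/funext => u; exact: (ff u). Qed.

Lemma slieC X Y : slie X Y = - slie Y X.
Proof.
by apply: val_inj; apply: etrans (lieC T X Y) _; exact/esym/field_ofN.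
Qed.

Lemma slie_jacobi X Y Z : slie X (slie Y Z) =
  slie (slie X Y) Z + slie Y (slie X Z).
Proof.
apply: val_inj; apply: etrans (esym (field_ofD _ _)).
exact: (lie_jacobi hT (smooth_fieldsP X) (smooth_fieldsP Y) (smooth_fieldsP Z)).
Qed.

Lemma sact_fieldD X Y f : sact (X + Y) f = sact X f + sact Y f.
Proof.
apply: val_inj; apply: etrans (esym (fun_ofD _ _)).
apply: etrans (congr1 (fun V => act T V f) (field_ofD X Y)) _.
exact: (act_fieldD hT X Y (smooth_funsP f)).
Qed.

Lemma sact_lie X Y f : sact (slie X Y) f =
  sact X (sact Y f) - sact Y (sact X f).
Proof.
apply: val_inj; apply: etrans (esym (fun_ofB _ _)).
exact: (act_lie hT (smooth_fieldsP X) (smooth_fieldsP Y) (smooth_funsP f)).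
Qed.

Lemma sJ_sJ X : sJ (sJ X) = 0.
Proof.
by apply: val_inj; apply: etrans (Jform_Jform X) _; exact/esym/field_of0.
Qed.

Lemma sJ_sC : sJ sC = 0.
Proof.
by apply: val_inj; apply: etrans (Jform_liouville M) _; exact/esym/field_of0.
Qed.

Lemma sJ_nijenhuis X Y : slie (sJ X) (sJ Y) =
  sJ (slie (sJ X) Y) + sJ (slie X (sJ Y)).
Proof.
apply: val_inj; apply: etrans (esym (field_ofD _ _)).
exact: (Jform_nijenhuis (smooth_fieldsP X) (smooth_fieldsP Y)).
Qed.

Lemma slie_sC_sJ X : slie sC (sJ X) = sJ (slie sC X) - sJ X.
Proof.
apply: val_inj; apply: etrans (esym (field_ofB _ _)).
exact: (lie_liouville_Jform (smooth_fieldsP X)).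
Qed.

Lemma semispray_sJ_slie S X : sJ S = sC -> sJ X = 0 -> sJ (slie X S) = X.
Proof.
move=> /(congr1 field_of) JS /(congr1 field_of) JX; apply: val_inj.
apply: (semispray_vertical (smooth_fieldsP S) (smooth_fieldsP X) JS).
exact: etrans JX field_of0.
Qed.

End SmoothModules.

Arguments field_of {R n M} _ _.
Arguments fun_of {R n M} _ _.

(** * The Chern connection of a Finsler space *)
Section FinslerSpace.
Context {R : realType} {n : nat} (M : manifold R n).
Variables (E : TM M -> R) (S : vfield M) (F : vfield M -> vfield M).
Variables (Cp D : vfield M -> vfield M -> vfield M).
Hypotheses (hE : finsler_energy E) (hS : canonical_spray E S).
Hypotheses (hF : almost_complex S F) (hCp : second_cartan_tensor E S F Cp).
Hypothesis hD : chern_connection E S F D.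
Local Notation T := (slit_atlas M).
Local Notation V := (smooth_fields M).
Let hT := slit_smooth_atlas M.
Implicit Types X Y Z : V.

Lemma energy_smooth : smooth_fun T (slit_restr E).
Proof. by have [_ _ []] := hE. Qed.

Lemma almost_complex_smooth (X : vfield M) : smooth_vfield X ->
  smooth_vfield (F X).
Proof. case: hF => -[sF _ _] _. exact: (sF X). Qed.

Lemma connection_smooth (X Y : vfield M) :
  smooth_vfield X -> smooth_vfield Y -> smooth_vfield (D X Y).
Proof.
case: hD => -[[sD _ _] _ _ _ _] _ _ sX sY.
case: (sD Y sY) => sDY _ _. exact: (sDY X sX).
Qed.

Lemma cartan_smooth (X Y : vfield M) :
  smooth_vfield X -> smooth_vfield Y -> smooth_vfield (Cp X Y).
Proof.
case: hCp => -[sC _] _ _ _ sX sY.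
case: (sC X sX) => sCX _ _. exact: (sCX Y sY).
Qed.

Definition sE : smooth_funs M := to_fun energy_smooth.

Definition sS : V := to_field hS.1.

Definition sF X : V := to_field (almost_complex_smooth (smooth_fieldsP X)).

Definition sD X Y : V :=
  to_field (connection_smooth (smooth_fieldsP X) (smooth_fieldsP Y)).

Definition sCp X Y : V :=
  to_field (cartan_smooth (smooth_fieldsP X) (smooth_fieldsP Y)).

Lemma to_additive (f : V -> V) : {morph f : X Y / X + Y} -> zmod_morphism f.
Proof.
by move=> fD X Y; apply: (addIr (f Y)); rewrite -fD !subrK.
Qed.

Fact sF_zmod_morphism : zmod_morphism sF.
Proof.
apply: to_additive => X Y; apply: val_inj; apply: etrans (esym (field_ofD _ _)).
apply: etrans (congr1 F (field_ofD X Y)) _; have [[_ FD _] _] := hF.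
by apply: FD; exact: smooth_fieldsP.
Qed.

Fact sD_zmod_morphism X : zmod_morphism (sD X).
Proof.
apply: to_additive => Y Z; apply: val_inj; apply: etrans (esym (field_ofD _ _)).
apply: etrans (congr1 (D X) (field_ofD Y Z)) _.
have [[[_ DD _] _ _ _ _] _ _] := hD.
by apply: DD; exact: smooth_fieldsP.
Qed.

HB.instance Definition _ := GRing.isZmodMorphism.Build V V sF sF_zmod_morphism.
HB.instance Definition _ X :=
  GRing.isZmodMorphism.Build V V (sD X) (sD_zmod_morphism X).

Local Notation hh := (horproj (@slie R n M) (@sJ R n M) sS).
Local Notation vv := (verproj (@slie R n M) (@sJ R n M) sS).
Local Notation om := (omega (@slie R n M) (@sact R n M) (@sJ R n M) sE).

Lemma field_of_almost_product X :
  field_of (almost_product (@slie R n M) (@sJ R n M) sS X) = barthel S X.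
Proof.
by apply: etrans (field_ofN _) _; apply: congr1; exact: field_ofB.
Qed.

Lemma field_of_horproj X : field_of (hh X) = hproj S X.
Proof.
apply: etrans (field_ofZ _ _) _; apply: congr1.
by apply: etrans (field_ofD _ _) _; rewrite field_of_almost_product.
Qed.

Lemma field_of_verproj X : field_of (vv X) = vproj S X.
Proof.
apply: etrans (field_ofZ _ _) _; apply: congr1.
by apply: etrans (field_ofB _ _) _; rewrite field_of_almost_product.
Qed.

Lemma fun_of_omega X Y : fun_of (om X Y) = Omega E X Y.
Proof.
by apply: etrans (fun_ofB _ _) _; apply: congr2 => //; exact: fun_ofB.
Qed.

Lemma sE_homogeneous : sact (sC M) sE = sE + sE.
Proof.
apply: val_inj; apply: etrans (esym (fun_ofD _ _)).
case: hE => _ _ _ CE _; apply: etrans CE _; apply/funext => u.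
by rewrite mulr_natl mulr2n.
Qed.

Lemma omega_nondegenerate X : (forall Y, om X Y = 0) -> X = 0.
Proof.
move=> X0; apply: val_inj; apply: etrans (esym (field_of0 M)).
case: hE => _ _ _ _ rank; apply/funext => u; apply: (rank u X).
  exact: smooth_fieldsP.
move=> Y sY; have := congr1 fun_of (X0 (to_field sY)).
by rewrite fun_of_omega fun_of0 => /(congr1 (fun f => f u)).
Qed.

Lemma omega_spray X : om sS X = - sact X sE.
Proof.
apply: val_inj; apply: etrans (esym (fun_ofN _));
  apply: etrans (fun_of_omega _ _) _.
exact: (hS.2 X (smooth_fieldsP X)).
Qed.

Lemma sD_fieldD X Y Z : sD (X + Y) Z = sD X Z + sD Y Z.
Proof.
apply: val_inj; apply: etrans (esym (field_ofD _ _)).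
apply: etrans (congr1 (D ^~ Z) (field_ofD X Y)) _.
case: hD => -[[sDD _ _] _ _ _ _] _ _.
case: (sDD Z (smooth_fieldsP Z)) => _ DDl _.
exact: (DDl _ _ (smooth_fieldsP X) (smooth_fieldsP Y)).
Qed.

Lemma sD_sJ X Y : sD X (sJ Y) = sJ (sD X Y).
Proof.
apply: val_inj; case: hD => -[_ DJ _ _ _] _ _.
exact: (DJ _ _ (smooth_fieldsP X) (smooth_fieldsP Y)).
Qed.

Lemma sD_sC X : sD X (sC M) = vv X.
Proof.
apply: val_inj; apply: etrans (esym (field_of_verproj _)).
case: hD => -[_ _ DC _ _] _ _; exact: (DC _ (smooth_fieldsP X)).
Qed.

Lemma sD_vertical X Y : sD (sJ X) (sJ Y) = sJ (slie (sJ X) Y).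
Proof.
apply: val_inj; case: hD => -[_ _ _ _ DJJ] _ _.
exact: (DJJ _ _ (smooth_fieldsP X) (smooth_fieldsP Y)).
Qed.

Lemma sD_torsion X Y :
  sJ (sD (hh X) (hh Y) - sD (hh Y) (hh X) - slie (hh X) (hh Y)) = 0.
Proof.
apply: val_inj; apply: etrans (esym (field_of0 M)).
case: hD => _ _ tor.
have := tor X Y (smooth_fieldsP X) (smooth_fieldsP Y).
rewrite /torsion -!field_of_horproj => <-; apply: (congr1 (@Jform R n M)).
apply: etrans (field_ofB _ _) _; apply: congr2 => //; exact: field_ofB.
Qed.

Lemma sF_sJ X : sF (sJ X) = hh X.
Proof.
apply: val_inj; apply: etrans (esym (field_of_horproj _)).
by case: hF => _ FJ; case: (FJ X (smooth_fieldsP X)).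
Qed.

Lemma sF_horproj X : sF (hh X) = - sJ X.
Proof.
apply: val_inj; apply: etrans (esym (field_ofN _)).
apply: etrans (congr1 F (field_of_horproj X)) _.
by case: hF => _ FJ; case: (FJ X (smooth_fieldsP X)).
Qed.

Lemma sD_metric X Y Z : sact (hh X) (om Y (sF Z)) =
  om (sD (hh X) Y) (sF Z) + om Y (sF (sD (hh X) Z)).
Proof.
apply: val_inj; apply: etrans (esym (fun_ofD _ _)).
rewrite !fun_of_omega; case: hD => _ met _.
have := met X Y Z (smooth_fieldsP X) (smooth_fieldsP Y) (smooth_fieldsP Z).
rewrite /metric -field_of_horproj => met'; apply: etrans met'.
exact: (congr1 (act T (hh X)) (fun_of_omega Y (sF Z))).
Qed.

Lemma sCpC X Y : sCp X Y = sCp Y X.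
Proof.
apply: val_inj; case: hCp => _ sym _ _.
exact: (sym _ _ (smooth_fieldsP X) (smooth_fieldsP Y)).
Qed.

Lemma sCpE X Y Z : om (sCp X Y) Z + om (sCp X Y) Z =
  sact (hh X) (om (sJ Y) (sF (sJ Z))) - om (slie (hh X) (sJ Y)) (sF (sJ Z))
  - om (sJ Y) (sF (slie (hh X) (sJ Z))).
Proof.
apply: val_inj; apply: etrans (fun_ofD _ _) _; rewrite fun_of_omega.
case: hCp => _ _ _ CE.
have := CE X Y Z (smooth_fieldsP X) (smooth_fieldsP Y) (smooth_fieldsP Z).
move=> CE'; apply: etrans (congr2 (fun f g : slit M -> R^o => f + g) CE' CE') _.
rewrite addr_half /lie_bilinear /metric -field_of_horproj.
have omega1 := congr1 (act T (hh X)) (fun_of_omega (sJ Y) (sF (sJ Z))).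
have omega2 := fun_of_omega (slie (hh X) (sJ Y)) (sF (sJ Z)).
have omega3 := fun_of_omega (sJ Y) (sF (slie (hh X) (sJ Z))).
pose sub (f g : slit M -> R^o) : slit M -> R^o := f - g.
have omega12 := etrans (fun_ofB (sact (hh X) (om (sJ Y) (sF (sJ Z))))
  (om (slie (hh X) (sJ Y)) (sF (sJ Z)))) (congr2 sub omega1 omega2).
apply/esym; apply: etrans (fun_ofB _ _) _.
exact: (congr2 sub omega12 omega3).
Qed.

Lemma smooth_chern_curvatures X Y Z :
  let K := curv (@slie R n M) (fun X => sD X : {additive V -> V}) in
  K (hh X) (hh Y) (sJ sS) =
    - (2^-1 *: fn_bracket_horproj (@slie R n M) (@sJ R n M) sS X Y) /\
  (K (hh X) (sJ Y) (sJ sS) = sCp X Y /\ K (hh sS) (sJ Y) (sJ X) = sCp X Y) /\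
  K (hh X) (sJ sS) (sJ Z) = 0.
Proof.
apply: (@chern_curvatures R V (smooth_funs M) _ _
  (fun i => component i : {additive V -> R})
  (fun u => value u : {additive smooth_funs M -> R})
  (@component_inj R n M) (@value_inj R n M) _ _ (@slieC R n M)
  (@slie_jacobi R n M) (@sact_fieldD R n M) (@sact_lie R n M) _ _
  (@sJ_sJ R n M) (@sJ_sC R n M) (@sJ_nijenhuis R n M) (@slie_sC_sJ R n M)
  (@semispray_sJ_slie R n M) _ sE_homogeneous omega_nondegenerate _
  omega_spray _ _ _ sD_fieldD sD_sJ sD_sC sD_vertical sD_torsion sF_sJ
    sF_horproj
  sD_metric sCpC sCpE).
Qed.

Lemma field_of_curv X Y Z :
  field_of (curv (@slie R n M) (fun X => sD X : {additive V -> V}) X Y Z) =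
  curvature T D X Y Z.
Proof.
pose sub (X Y : slit M -> 'rV[R]_(n + n)) := X - Y.
apply: etrans (field_ofB _ _) _.
exact: (congr1 (fun W => sub W (D (lie T X Y) Z)) (field_ofB _ _)).
Qed.

Lemma field_of_fn_bracket X Y :
  field_of (fn_bracket_horproj (@slie R n M) (@sJ R n M) sS X Y) =
  fn_form_form T (hproj S) (hproj S) X Y.
Proof.
rewrite /fn_bracket_horproj 4!field_ofB 3!field_ofD.
by rewrite !field_of_horproj !field_of_slie !field_of_horproj.
Qed.

End FinslerSpace.

Theorem proposition4p5 (R : realType) (n : nat) (M : manifold R n)
    (E : TM M -> R) (S : vfield M) (F : vfield M -> vfield M)
    (Cp D : vfield M -> vfield M -> vfield M)
    (hE : finsler_energy E) (hS : canonical_spray E S)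
    (hF : almost_complex S F) (hCp : second_cartan_tensor E S F Cp)
    (hD : chern_connection E S F D)
    (X Y Z : vfield M)
    (hX : smooth_vfield X) (hY : smooth_vfield Y) (hZ : smooth_vfield Z) :
  h_curvature S D X Y S = barthel_curvature S X Y /\
  (hv_curvature S D X Y S = Cp X Y /\ hv_curvature S D S Y X = Cp X Y) /\
  hv_curvature S D X S Z = 0.
Proof.
have [] := smooth_chern_curvatures hE hS hF hCp hD
  (to_field hX) (to_field hY) (to_field hZ).
move=> /(congr1 field_of) Ra [[/(congr1 field_of) Pb1 /(congr1 field_of) Pb2]].
move=> /(congr1 field_of) Pc.
move: Ra Pb1 Pb2 Pc; rewrite !field_of_curv !field_of_horproj => Ra Pb1 Pb2 Pc.
split; last by split; [split|exact: etrans Pc (field_of0 M)].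
apply: etrans Ra _; apply: etrans (field_ofN _) _; apply: congr1.
by apply: etrans (field_ofZ _ _) _; apply: congr1; exact: field_of_fn_bracket.
Qed.
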